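(* Let $\mathcal{X},\mathcal{Y},\mathcal{Z}$ be finite sets, $f\subseteq\mathcal{X}\times\mathcal{Y}\times\mathcal{Z}$ a relation, and $t>1$ an integer. Let $\mu$ be a distribution on $\mathcal{X}\times\mathcal{Y}$, let $z\in\mathcal{Z}$ and $\beta:=\Pr_{(x,y)\leftarrow\mu}[f(x,y)=\{z\}]$. Let $0<\varepsilon<1/3$ and $\varepsilon',\delta>0$ be such that $\frac{\delta+22\varepsilon}{\beta-33\varepsilon}<(1+\varepsilon')\frac{\delta}{\beta}$. Then \[\mathrm{R}^{\mathrm{pub}}_{1-(1-\varepsilon)^{\lfloor\varepsilon^2 t/32\rfloor}}(f^t)\;\geq\;\frac{\varepsilon^2}{32}\cdot t\cdot\Big(11\varepsilon\cdot\widetilde{\mathrm{srec}}^{z,\mu}_{(1+\varepsilon')\delta/\beta,\;\delta}(f)-2\Big).\]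
   Context: Notation: for a relation $f$, $f(x,y):=\{z:(x,y,z)\in f\}$ and $f^{-1}(z):=\{(x,y):(x,y,z)\in f\}$. $f^t\subseteq\mathcal{X}^t\times\mathcal{Y}^t\times\mathcal{Z}^t$ is the relation with $((x_1..x_t),(y_1..y_t),(z_1..z_t))\in f^t$ iff $(x_i,y_i,z_i)\in f$ for all $i$. $\mathrm{R}^{\mathrm{pub}}_{\eta}(g)$ is the two-way public-coin randomized communication complexity of $g$ with worst-case error $\eta$: the minimum number of bits communicated by a two-way public-coin protocol whose output is a valid answer (in $g$) with probability at least $1-\eta$ on every input. Smooth rectangle bound: for a distribution $\lambda$ on $\mathcal{X}\times\mathcal{Y}$, a relation $g$, $z\in\mathcal{Z}$ and $\varepsilon\ge0$, $\widetilde{\mathrm{rec}}^{z,\lambda}_{\varepsilon}(g):=\min\{\log_2(1/\lambda(R)) : R=A\times B\subseteq\mathcal{X}\times\mathcal{Y}\text{ a rectangle with }\lambda(R)>0,\ \lambda(g^{-1}(z)\cap R)\ge(1-\varepsilon)\lambda(R)\}$ (equivalently the min of $S_\infty(\lambda_R\|\lambda)$ where $\lambda_R$ is $\lambda$ conditioned on $R$ and $S_\infty(P\|Q)=\max_x\log(P(x)/Q(x))$). For $\delta\ge0$, $\widetilde{\mathrm{srec}}^{z,\lambda}_{\varepsilon,\delta}(f):=\max\{\widetilde{\mathrm{rec}}^{z,\lambda}_{\varepsilon}(g): g\subseteq\mathcal{X}\times\mathcal{Y}\times\mathcal{Z},\ \Pr_{(x,y)\leftarrow\lambda}[f(x,y)\neq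 g(x,y)]\le\delta\}$.
   Formalization: The formal theorem assumes in addition 33ε < β, so that the denominators β − 33ε and β are positive; when 0 < β < 33ε the assumed inequality holds automatically and the claim fails (e.g. for Equality with ε = 0.3). *)

(* Defs.v *)
From Stdlib Require Import Reals.
From mathcomp Require Import all_boot.

Set Implicit Arguments.
Unset Strict Implicit.
Unset Printing Implicit Defensive.

Local Open Scope R_scope.

Definition log2 (x : R) : R := ln x / ln 2.

Definition nat_floor (x : R) : nat := Z.to_nat (Int_part x).

Definition Rmin_seq (s : seq R) : R :=
  match s with [::] => 0 | a :: s' => foldr Rmin a s' end.
Definition Rmax_seq (s : seq R) : R :=
  match s with [::] => 0 | a :: s' => foldr Rmax a s' end.

Definition Rltb (a b : R) : bool := if Rlt_dec a b then true else false.
Definition Rleb (a b : R) : bool := if Rle_dec a b then true else false.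

Definition relation3 (X Y Z : finType) := {set (X * Y * Z)%type}.

Definition rel_at (X Y Z : finType) (f : relation3 X Y Z) (x : X) (y : Y)
  : {set Z} := [set z | (x, y, z) \in f].

Definition rel_pow (X Y Z : finType) (f : relation3 X Y Z) (t : nat)
  (x : {ffun 'I_t -> X}) (y : {ffun 'I_t -> Y}) (z : {ffun 'I_t -> Z}) : bool :=
  [forall i, (x i, y i, z i) \in f].

Definition is_distr (T : finType) (mu : T -> R) : Prop :=
  (forall p, 0 <= mu p) /\ \big[Rplus/0]_(p : T) mu p = 1.

Definition prob (T : finType) (mu : T -> R) (P : pred T) : R :=
  \big[Rplus/0]_(p : T | P p) mu p.

Inductive proto (A B O : Type) : Type :=
| PLeaf  : O -> proto A B O
| PAlice : (A -> bool) -> proto A B O -> proto A B O -> proto A B O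
| PBob   : (B -> bool) -> proto A B O -> proto A B O -> proto A B O.

Fixpoint run (A B O : Type) (P : proto A B O) (a : A) (b : B) : O :=
  match P with
  | PLeaf o => o
  | PAlice g l r => if g a then run l a b else run r a b
  | PBob g l r => if g b then run l a b else run r a b
  end.

Fixpoint depth (A B O : Type) (P : proto A B O) : nat :=
  match P with
  | PLeaf _ => 0
  | PAlice _ l r => (maxn (depth l) (depth r)).+1
  | PBob _ l r => (maxn (depth l) (depth r)).+1
  end.

(* A public-coin protocol: a probability distribution (given by the list of
   weighted deterministic protocols) over deterministic protocols selected by
   the public random string. *)
Definition pubproto (A B O : Type) := seq (R * proto A B O).

Definition pub_wf (A B O : Type) (P : pubproto A B O) : Prop :=
  (forall wp, List.In wp P -> 0 <= wp.1) /\
  \big[Rplus/0]_(wp <- P) wp.1 = 1.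

Definition pub_cost (A B O : Type) (P : pubproto A B O) : nat :=
  \max_(wp <- P) depth wp.2.

Definition pub_err (A B O : Type) (g : A -> B -> O -> bool)
  (P : pubproto A B O) (a : A) (b : B) : R :=
  \big[Rplus/0]_(wp <- P | ~~ g a b (run wp.2 a b)) wp.1.

(* "R^pub_eta(g) >= r": every public-coin protocol whose output is a valid
   answer with probability >= 1 - eta on every input communicates at least r
   bits in the worst case (i.e. min{cost} >= r, with min of the empty set
   being +infinity). *)
Definition Rpub_ge (A B O : Type) (g : A -> B -> O -> bool) (eta r : R)
  : Prop :=
  forall P : pubproto A B O, pub_wf P ->
    (forall a b, pub_err g P a b <= eta) ->
    r <= INR (pub_cost P).

Section SRec.
Variables (X Y Z : finType).

Definition in_rect (AB : {set X} * {set Y}) (p : X * Y) : bool :=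
  (p.1 \in AB.1) && (p.2 \in AB.2).

Definition rect_ok (lam : X * Y -> R) (g : relation3 X Y Z) (z : Z) (eps : R)
  (AB : {set X} * {set Y}) : bool :=
  Rltb 0 (prob lam (in_rect AB)) &&
  Rleb ((1 - eps) * prob lam (in_rect AB))
       (prob lam (fun p => in_rect AB p && (z \in rel_at g p.1 p.2))).

Definition rec (lam : X * Y -> R) (g : relation3 X Y Z) (z : Z) (eps : R) : R :=
  Rmin_seq [seq log2 (/ prob lam (in_rect AB))
           | AB <- enum {: {set X} * {set Y}} & rect_ok lam g z eps AB].

Definition srec (lam : X * Y -> R) (f : relation3 X Y Z) (z : Z)
  (eps delta : R) : R :=
  Rmax_seq [seq rec lam g z eps
           | g <- enum {: relation3 X Y Z}
           & Rleb (prob lam (fun p => rel_at f p.1 p.2 != rel_at g p.1 p.2))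
                  delta].
End SRec.

(* Main.v *)
(** Fix the public coins and let [P] be the distribution of the [t] instances conditioned on
    the protocol being correct on a set [C] of coordinates.  Writing [m] for the leaf reached
    and [r_j] for the inputs of [C] together with [x_i] for [i < j] and [y_i] for [i > j], the
    law of [(x_j, y_j, r_j, m)] under [P] has a density with respect to [mu (x_j, y_j)] that is
    a product of a function of [x_j] and a function of [y_j].  By the chain rule and
    submodularity of entropy, for most [j] the relative entropies of this law with respect to
    [mu (x_j, y_j) P(r_j, m | x_j)] and [mu (x_j, y_j) P(r_j, m | y_j)] are small, so that the
    two players can truncate their factors and sample [(r_j, m)] without communication.  This
    yields random rectangles of measure about [2 ^ (- srec / 2)] on which the output [z] is as
    reliable as the protocol is on coordinate [j].  The smooth rectangle bound forbids this
    reliability, hence conditioned on success on [C] some coordinate fails with probability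
    more than [eps]; adding such coordinates to [C] one at a time gives the theorem. *)

From Stdlib Require Import ZArith Reals Lra Lia.
From Coquelicot Require Import Rcomplements.
From mathcomp Require Import all_boot Rstruct.
Require Import Defs.

Set Implicit Arguments.
Unset Strict Implicit.
Unset Printing Implicit Defensive.

Local Open Scope R_scope.

Local Notation "\sum_ ( i <- r | P ) F" := (\big[Rplus/0]_(i <- r | P%B) F) : R_scope.
Local Notation "\sum_ ( i <- r ) F" := (\big[Rplus/0]_(i <- r) F) : R_scope.
Local Notation "\sum_ ( i | P ) F" := (\big[Rplus/0]_(i | P%B) F) : R_scope.
Local Notation "\sum_ i F" := (\big[Rplus/0]_i F) : R_scope.
Local Notation "\sum_ ( i : t ) F" := (\big[Rplus/0]_(i : t) F) (only parsing) : R_scope.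
Local Notation "\sum_ ( i : t | P ) F" := (\big[Rplus/0]_(i : t | P%B) F) (only parsing) : R_scope.
Local Notation "\sum_ ( i < n ) F" := (\big[Rplus/0]_(i < n) F) : R_scope.
Local Notation "\sum_ ( i < n | P ) F" := (\big[Rplus/0]_(i < n | P%B) F) : R_scope.
Local Notation "\prod_ ( i <- r | P ) F" := (\big[Rmult/1]_(i <- r | P%B) F) : R_scope.
Local Notation "\prod_ ( i | P ) F" := (\big[Rmult/1]_(i | P%B) F) : R_scope.
Local Notation "\prod_ i F" := (\big[Rmult/1]_i F) : R_scope.
Local Notation "\prod_ ( i : t ) F" := (\big[Rmult/1]_(i : t) F) (only parsing) : R_scope.

(** * Real numbers and finite sums *)

Lemma RlebP (a b : R) : reflect (a <= b) (Rleb a b).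
Proof. by rewrite /Rleb; case: Rle_dec => h; constructor. Qed.

Lemma RltbP (a b : R) : reflect (a < b) (Rltb a b).
Proof. by rewrite /Rltb; case: Rlt_dec => h; constructor. Qed.

Lemma Rleb_total : total Rleb.
Proof. by move=> x y; case: (RlebP x y) => //; case: (RlebP y x) => //; lra. Qed.

Lemma Rleb_refl : reflexive Rleb.
Proof. by move=> x; apply/RlebP; exact: Rle_refl. Qed.

Lemma Rleb_trans : transitive Rleb.
Proof. by move=> y x z /RlebP xy /RlebP yz; apply/RlebP; exact: Rle_trans yz. Qed.

Lemma Rdiv_ge0 (x y : R) : 0 <= x -> 0 <= y -> 0 <= x / y.
Proof.
by move=> x_ge0 [y_gt0|<-]; [exact: Rle_mult_inv_pos | rewrite Rdiv_0_r; exact: Rle_refl].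
Qed.

Lemma Rmult_div_le (x y : R) : 0 <= y -> x * (y / x) <= y.
Proof.
move=> y_ge0; case: (Req_dec x 0) => [->|x_neq0]; first by rewrite Rmult_0_l.
by right; field.
Qed.

Lemma exp_le_compat (x y : R) : x <= y -> exp x <= exp y.
Proof. by case=> [/exp_increasing|->]; [exact: Rlt_le | exact: Rle_refl]. Qed.

Lemma ln_ge_1sub (x : R) : 0 < x -> 1 - / x <= ln x.
Proof. by move=> x_gt0; have := exp_ineq1_le (- ln x); rewrite exp_Ropp exp_ln //; lra. Qed.

Lemma exp1_ge : 2.44 <= exp 1.
Proof.
have e_quarter := exp_ineq1_le (1 / 4).
have -> : exp 1 = exp (1 / 4) * exp (1 / 4) * (exp (1 / 4) * exp (1 / 4)).
  by rewrite -!exp_plus; congr exp; lra.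
have : 1.5625 <= exp (1 / 4) * exp (1 / 4) by nra.
nra.
Qed.

Lemma exp_ge_square (u : R) : 0 <= u -> (exp 1 * (u / 2)) ^ 2 <= exp u.
Proof.
move=> u_ge0; have -> : exp u = exp (u / 2) ^ 2 by rewrite /= Rmult_1_r -exp_plus; congr exp; lra.
apply: pow_incr; split; first by apply: Rmult_le_pos; [exact/Rlt_le/exp_pos | lra].
have -> : exp (u / 2) = exp 1 * exp (u / 2 - 1) by rewrite -exp_plus; congr exp; lra.
by apply: Rmult_le_compat_l; [exact/Rlt_le/exp_pos | have := exp_ineq1_le (u / 2 - 1); lra].
Qed.

Lemma exp_sub1_le (x : R) : 0 <= x <= 1 / 2 -> exp x - 1 <= x * (1 + 2 * x).
Proof.
move=> [x_ge0 x_le]; have exp_neg := exp_ineq1_le (- x); have exp_gt0 := exp_pos x.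
have : exp x * exp (- x) = 1 by rewrite -exp_plus Rplus_opp_r exp_0.
move=> inv; have : exp x * (1 - x) <= 1 by nra.
nra.
Qed.

Lemma one_sub_exp_opp_ge (x : R) : 0 <= x -> x * (1 - x) <= 1 - exp (- x).
Proof.
move=> x_ge0; have exp_ge := exp_ineq1_le x; rewrite exp_Ropp.
have : / exp x <= / (1 + x) by apply: Rinv_le_contravar; lra.
have : / (1 + x) <= 1 - x + x * x; last by lra.
by apply: (Rmult_le_reg_l (1 + x)); [lra | rewrite Rinv_r; nra].
Qed.

Section SumLemmas.
Variables (I : Type) (r : seq I).
Implicit Types (P : pred I) (F G : I -> R).

Lemma Rsum_ge0 P F : (forall i, P i -> 0 <= F i) -> 0 <= \sum_(i <- r | P i) F i.
Proof. by move=> F_ge0; elim/big_ind: _ => // *; lra. Qed.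

Lemma Rsum_le P F G : (forall i, P i -> F i <= G i) ->
  \sum_(i <- r | P i) F i <= \sum_(i <- r | P i) G i.
Proof. by move=> le_FG; elim/big_ind2: _ => // *; lra. Qed.

Lemma Rsum_le_subpred P1 P2 F : (forall i, P1 i -> P2 i) -> (forall i, 0 <= F i) ->
  \sum_(i <- r | P1 i) F i <= \sum_(i <- r | P2 i) F i.
Proof.
move=> P12 F_ge0; rewrite big_mkcond [X in _ <= X]big_mkcond; apply: Rsum_le => i _.
by case: ifP => [/P12 ->|_]; [lra | case: ifP => _ //; lra].
Qed.

Lemma RsumN P F : \sum_(i <- r | P i) - F i = - \sum_(i <- r | P i) F i.
Proof. by elim/big_rec2: _ => [|i y1 y2 _ ->]; lra. Qed.

Lemma RsumB P F G : \sum_(i <- r | P i) (F i - G i) =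
  \sum_(i <- r | P i) F i - \sum_(i <- r | P i) G i.
Proof. by rewrite big_split /= RsumN. Qed.

Lemma Rmult_suml P F c : (\sum_(i <- r | P i) F i) * c = \sum_(i <- r | P i) F i * c.
Proof. by rewrite big_distrl. Qed.

Lemma Rmult_sumr P F c : c * (\sum_(i <- r | P i) F i) = \sum_(i <- r | P i) c * F i.
Proof. by rewrite big_distrr. Qed.

Lemma Rprod_ge0 P F : (forall i, P i -> 0 <= F i) -> 0 <= \prod_(i <- r | P i) F i.
Proof. by move=> F_ge0; elim/big_ind: _ => //; [lra | exact: Rmult_le_pos]. Qed.

Lemma Rprod_gt0 P F : (forall i, P i -> 0 < F i) -> 0 < \prod_(i <- r | P i) F i.
Proof. by move=> F_gt0; elim/big_ind: _ => //; [lra | exact: Rmult_lt_0_compat]. Qed.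

Lemma ln_prod P F : (forall i, P i -> 0 < F i) ->
  ln (\prod_(i <- r | P i) F i) = \sum_(i <- r | P i) ln (F i).
Proof.
move=> F_gt0.
suff: 0 < \prod_(i <- r | P i) F i /\
  ln (\prod_(i <- r | P i) F i) = \sum_(i <- r | P i) ln (F i) by case.
elim/big_ind2: _ => [|x1 x2 y1 y2 [x1_gt0 ln_x1] [y1_gt0 ln_y1]|i Pi].
- by split; [lra | exact: ln_1].
- by split; [exact: Rmult_lt_0_compat | rewrite ln_mult // ln_x1 ln_y1].
- by split; [exact: F_gt0|].
Qed.

End SumLemmas.

Lemma Rsum_ge_term (I : finType) (P : pred I) (F : I -> R) (i : I) :
  P i -> (forall i, P i -> 0 <= F i) -> F i <= \sum_(i | P i) F i.
Proof.
move=> Pi F_ge0; rewrite (bigD1 i) //=.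
suff : 0 <= \sum_(j | P j && (j != i)) F j by lra.
by apply: Rsum_ge0 => j /andP[/F_ge0].
Qed.

Lemma Rsum_const (I : finType) (D : pred I) (c : R) : \sum_(i | D i) c = INR #|D| * c.
Proof.
rewrite big_const; elim: #|D| => [|n IH]; first by rewrite /=; lra.
by rewrite iterS IH S_INR; lra.
Qed.

Lemma INR_card_gt0 (I : finType) (i : I) : 0 < INR #|I|.
Proof. by apply: lt_0_INR; apply/ltP/card_gt0P; exists i. Qed.

Lemma Rsum_telescope (n : nat) (a : nat -> R) : \sum_(i < n) (a i.+1 - a i) = a n - a 0%N.
Proof.
elim: n => [|n IH]; first by rewrite big_ord0; lra.
by rewrite big_ord_recr /= IH; lra.
Qed.

Lemma Rsum_pair (I J : finType) (F : I * J -> R) : \sum_u F u = \sum_i \sum_j F (i, j).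
Proof. by rewrite pair_big; apply: eq_bigr => -[]. Qed.

(** * Probability *)

Section Probability.
Variables (W : finType) (P : W -> R).
Implicit Types (A B : pred W).

Lemma prob_distr_le1 A : is_distr P -> prob P A <= 1.
Proof. by case=> P_ge0 <-; exact: Rsum_le_subpred. Qed.

Lemma prob_compl A : is_distr P -> prob P (predC A) = 1 - prob P A.
Proof. by case=> _ <-; rewrite /prob [in RHS](bigID A) /=; lra. Qed.

Lemma distr_inhabited : is_distr P -> inhabited W.
Proof.
case=> _ P_sum; case: (pickP W) => [w _|W0]; first by exists.
by move: P_sum; rewrite (eq_bigl _ _ W0) big_pred0_eq; lra.
Qed.

Lemma eq_prob A B : A =1 B -> prob P A = prob P B.
Proof. exact: eq_bigl. Qed.

Hypothesis P_ge0 : forall w, 0 <= P w.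

Lemma prob_ge0 A : 0 <= prob P A.
Proof. exact: Rsum_ge0. Qed.

Lemma prob_le A B : (forall w, A w -> B w) -> prob P A <= prob P B.
Proof. by move=> AB; exact: Rsum_le_subpred. Qed.

End Probability.

Definition expect (W : finType) (P F : W -> R) : R := \sum_w P w * F w.

Section Expectation.
Variables (W : finType) (P : W -> R).
Implicit Types (F G : W -> R).

Lemma expectD F G : expect P (fun w => F w + G w) = expect P F + expect P G.
Proof. by rewrite -big_split; apply: eq_bigr => w _; exact: Rmult_plus_distr_l. Qed.

Lemma expectB F G : expect P (fun w => F w - G w) = expect P F - expect P G.
Proof. by rewrite -RsumB; apply: eq_bigr => w _; exact: Rmult_minus_distr_l. Qed.

Lemma expect_sum (I : finType) (D : pred I) (F : I -> W -> R) :
  expect P (fun w => \sum_(i | D i) F i w) = \sum_(i | D i) expect P (F i).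
Proof. by rewrite [RHS]exchange_big; apply: eq_bigr => w _ /=; rewrite Rmult_sumr. Qed.

Lemma expect_const (k : R) : is_distr P -> expect P (fun _ => k) = k.
Proof. by case=> _ P_sum; rewrite /expect -Rmult_suml P_sum Rmult_1_l. Qed.

Lemma expect_ind A : expect P (fun w => if A w then 1 else 0) = prob P A.
Proof. by rewrite /prob big_mkcond; apply: eq_bigr => w _; case: ifP; lra. Qed.

Hypothesis P_ge0 : forall w, 0 <= P w.

Lemma le_expect F G : (forall w, 0 < P w -> F w <= G w) -> expect P F <= expect P G.
Proof.
move=> FG; apply: Rsum_le => w _.
case: (Rle_lt_or_eq_dec _ _ (P_ge0 w)) => [Pw|<-]; last lra.
by apply: Rmult_le_compat_l => //; exact: FG.
Qed.

Lemma eq_expect F G : (forall w, 0 < P w -> F w = G w) -> expect P F = expect P G.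
Proof. by move=> FG; apply: Rle_antisym; apply: le_expect => w /FG ->; exact: Rle_refl. Qed.

Lemma prob_union_le (A B C : pred W) : (forall w, 0 < P w -> A w -> B w || C w) ->
  prob P A <= prob P B + prob P C.
Proof.
move=> ABC; rewrite -!expect_ind -expectD; apply: le_expect => w /ABC.
by case: (A w) => [/(_ isT)|_]; case: (B w); case: (C w) => //=; lra.
Qed.

End Expectation.

(** * Laws of observables *)

Definition is_subdistr (T : finType) (Q : T -> R) : Prop :=
  (forall i, 0 <= Q i) /\ \sum_i Q i <= 1.

Definition dominated (T : finType) (P Q : T -> R) : Prop := forall i, 0 < P i -> 0 < Q i.

Lemma is_distr_subdistr (T : finType) (P : T -> R) : is_distr P -> is_subdistr P.
Proof. by case=> P_ge0 P_sum; split=> //; exact: Req_le. Qed.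

Lemma subdistr_kernel (I J : finType) (Q : I -> R) (K : I -> J -> R) :
  is_subdistr Q -> (forall i, is_subdistr (K i)) ->
  is_subdistr (fun u : I * J => Q u.1 * K u.1 u.2).
Proof.
move=> [Q_ge0 Q_le1] K_sub; split=> [u|].
  by apply: Rmult_le_pos => //; exact: (K_sub _).1.
rewrite Rsum_pair; apply: Rle_trans Q_le1; apply: Rsum_le => i _ /=; rewrite -Rmult_sumr.
by have := Rmult_le_compat_l _ _ _ (Q_ge0 i) (K_sub i).2; rewrite Rmult_1_r.
Qed.

Definition law (W A : finType) (P : W -> R) (phi : W -> A) (a : A) : R :=
  prob P (fun w => phi w == a).

Definition cond_law (W A B : finType) (P : W -> R) (phi : W -> A) (psi : W -> B)
    (a : A) (b : B) : R :=
  law P (fun w => (phi w, psi w)) (a, b) / law P phi a.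

Definition refines (W A B : Type) (phi : W -> A) (psi : W -> B) : Prop :=
  forall v w, phi v = phi w -> psi v = psi w.

Section Laws.
Variables (W : finType) (P : W -> R).
Implicit Types A B : finType.

Lemma expect_law A (phi : W -> A) (F : A -> R) :
  expect (law P phi) F = expect P (fun w => F (phi w)).
Proof.
rewrite /expect [RHS](partition_big phi xpredT) //=; apply: eq_bigr => a _.
by rewrite Rmult_suml; apply: eq_bigr => w /eqP ->.
Qed.

Lemma prob_law A (phi : W -> A) (E : pred A) :
  prob (law P phi) E = prob P (fun w => E (phi w)).
Proof. by rewrite -!expect_ind expect_law. Qed.

Lemma sum_law_pair A B (phi : W -> A) (psi : W -> B) a :
  \sum_b law P (fun w => (phi w, psi w)) (a, b) = law P phi a.
Proof. by rewrite /law /prob [RHS](partition_big psi xpredT). Qed.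

Hypothesis P_distr : is_distr P.
Let P_ge0 : forall w, 0 <= P w := P_distr.1.

Lemma law_distr A (phi : W -> A) : is_distr (law P phi).
Proof.
split=> [a|]; first exact: prob_ge0.
by rewrite -P_distr.2; exact: (prob_law phi xpredT).
Qed.

Lemma law_gt0 A (phi : W -> A) w : 0 < P w -> 0 < law P phi (phi w).
Proof.
move=> Pw; apply: Rlt_le_trans Pw _.
exact: (Rsum_ge_term (P := fun v => phi v == phi w)).
Qed.

Lemma law_dominated A (phi : W -> A) (Q : A -> R) :
  (forall w, 0 < P w -> 0 < Q (phi w)) -> dominated (law P phi) Q.
Proof.
move=> PQ a law_a; apply: Rnot_le_lt => Qa; move: law_a.
rewrite /law /prob big1 => [|w /eqP phiw]; first lra.
by case: (Rle_lt_or_eq_dec _ _ (P_ge0 w)) => // /PQ; rewrite phiw; lra.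
Qed.

Lemma le_law A B (phi : W -> A) (psi : W -> B) w :
  refines phi psi -> law P phi (phi w) <= law P psi (psi w).
Proof. by move=> ref; apply: prob_le => // v /eqP/ref ->. Qed.

Lemma eq_law A B (phi : W -> A) (psi : W -> B) w :
  refines phi psi -> refines psi phi -> law P phi (phi w) = law P psi (psi w).
Proof. by move=> *; apply: Rle_antisym; exact: le_law. Qed.

Lemma cond_law_subdistr A B (phi : W -> A) (psi : W -> B) a :
  is_subdistr (cond_law P phi psi a).
Proof.
split=> [b|]; first by apply: Rdiv_ge0; apply: prob_ge0.
rewrite /cond_law /Rdiv -Rmult_suml sum_law_pair.
case: (Req_dec (law P phi a) 0) => [->|law_n0]; first by rewrite Rmult_0_l; lra.
by rewrite Rinv_r //; exact: Rle_refl.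
Qed.

Lemma cond_law_gt0 A B (phi : W -> A) (psi : W -> B) w :
  0 < P w -> 0 < cond_law P phi psi (phi w) (psi w).
Proof.
move=> Pw; apply: Rdiv_lt_0_compat; last exact: law_gt0.
exact: (law_gt0 (fun w => (phi w, psi w))).
Qed.

End Laws.

(** * Relative entropy *)

Definition kl (T : finType) (P Q : T -> R) : R := expect P (fun i => ln (P i / Q i)).

(* Fenchel-Young for the conjugate pair [p ln p - p] and [exp]. *)
Lemma mult_ln_div_ge (p q s : R) : 0 <= p -> 0 <= q -> (0 < p -> 0 < q) ->
  p * s + p - q * exp s <= p * ln (p / q).
Proof.
move=> p_ge0 q_ge0 pq; have exp_gt0 := exp_pos s.
case: (Rle_lt_or_eq_dec _ _ p_ge0) => [p_gt0|<-]; last first.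
  by have := Rmult_le_pos _ _ q_ge0 (Rlt_le _ _ exp_gt0); lra.
have q_gt0 := pq p_gt0; have qexp_gt0 : 0 < q * exp s by exact: Rmult_lt_0_compat.
have := Rmult_le_compat_l _ _ _ p_ge0 (ln_ge_1sub (Rdiv_lt_0_compat _ _ p_gt0 qexp_gt0)).
rewrite Rinv_div !ln_div // ln_mult // ln_exp.
have -> : p * (1 - q * exp s / p) = p - q * exp s by field; lra.
lra.
Qed.

Section RelativeEntropy.
Variables (T : finType) (P Q : T -> R).
Hypotheses (P_distr : is_distr P) (Q_subdistr : is_subdistr Q) (PQ : dominated P Q).

(* Donsker-Varadhan with the test function [s * 1_E], linearised by [ln u <= u - 1]. *)
Lemma kl_event (E : pred T) (s : R) :
  s * prob P E <= kl P Q + (exp s - 1) * prob Q E.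
Proof.
pose test i := if E i then s else 0.
have : \sum_i (P i * test i + P i - Q i * exp (test i)) <= kl P Q.
  apply: Rsum_le => i _; apply: mult_ln_div_ge; first exact: P_distr.1.
    exact: Q_subdistr.1.
  exact: PQ.
rewrite RsumB big_split /= P_distr.2.
have -> : \sum_i P i * test i = s * prob P E.
  rewrite /prob Rmult_sumr big_mkcond [RHS]big_mkcond; apply: eq_bigr => i _.
  by rewrite /test; case: ifP; lra.
have -> : \sum_i Q i * exp (test i) = \sum_i Q i + (exp s - 1) * prob Q E.
  rewrite /prob Rmult_sumr [X in _ + X]big_mkcond -big_split; apply: eq_bigr => i _ /=.
  by rewrite /test; case: ifP; rewrite ?exp_0; lra.
by have := Q_subdistr.2; lra.
Qed.

Lemma kl_ge0 : 0 <= kl P Q.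
Proof. by have := kl_event xpredT 0; rewrite exp_0; lra. Qed.

Lemma kl_tail (s : R) : (s - 1) * prob P (fun i => ~~ Rleb (P i) (exp s * Q i)) <= kl P Q.
Proof.
set E : pred T := fun i => _; have := kl_event E s.
have : exp s * prob Q E <= prob P E.
  by rewrite /prob Rmult_sumr; apply: Rsum_le => i /RlebP /Rnot_le_lt /Rlt_le.
have : 0 <= prob Q E by apply: prob_ge0; exact: Q_subdistr.1.
lra.
Qed.

Lemma prob_le_of_kl_le (E : pred T) (eps : R) : 0 < eps <= 1 / 2 -> kl P Q <= eps * eps ->
  prob P E <= prob Q E + 3 * eps.
Proof.
move=> [eps_gt0 eps_le] kl_le; have Q_ge0 : 0 <= prob Q E by exact: prob_ge0 Q_subdistr.1 _.
have Q_le1 : prob Q E <= 1.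
  by apply: Rle_trans Q_subdistr.2; exact: Rsum_le_subpred Q_subdistr.1.
have exp_eps := exp_sub1_le (conj (Rlt_le _ _ eps_gt0) eps_le).
apply: (Rmult_le_reg_l eps) => //; apply: Rle_trans (kl_event E eps) _.
by have := Rmult_le_compat_r _ _ _ Q_ge0 exp_eps; nra.
Qed.

Lemma klE : kl P Q = expect P (fun i => ln (P i)) - expect P (fun i => ln (Q i)).
Proof.
rewrite -expectB; apply: (eq_expect P_distr.1) => i Pi; apply: ln_div => //; exact: PQ.
Qed.

End RelativeEntropy.

(* The entropy of the observable [phi], with the opposite sign. *)
Definition negent (W A : finType) (P : W -> R) (phi : W -> A) : R :=
  expect P (fun w => ln (law P phi (phi w))).

Section NegativeEntropy.
Variables (W : finType) (P : W -> R).
Hypothesis P_distr : is_distr P.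
Implicit Types A B C : finType.

Lemma le_negent A B (phi : W -> A) (psi : W -> B) :
  refines phi psi -> negent P phi <= negent P psi.
Proof.
move=> ref; apply: (le_expect P_distr.1) => w Pw.
by apply: ln_le; [exact: law_gt0 | exact: le_law].
Qed.

Lemma eq_negent A B (phi : W -> A) (psi : W -> B) :
  refines phi psi -> refines psi phi -> negent P phi = negent P psi.
Proof. by move=> *; apply: Rle_antisym; exact: le_negent. Qed.

Lemma kl_law_negent A (phi : W -> A) (Q : A -> R) :
  (forall w, 0 < P w -> 0 < Q (phi w)) ->
  kl (law P phi) Q = negent P phi - expect P (fun w => ln (Q (phi w))).
Proof.
move=> PQ; rewrite klE; [|exact: law_distr|exact: law_dominated].
by rewrite !expect_law.
Qed.

Lemma eq_kl_law A B (phi : W -> A) (psi : W -> B) (Q : A -> R) (Q' : B -> R) :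
  refines phi psi -> refines psi phi -> (forall w, Q (phi w) = Q' (psi w)) ->
  kl (law P phi) Q = kl (law P psi) Q'.
Proof.
move=> ref ref' eqQ; rewrite /kl !expect_law; apply: eq_bigr => w _.
by rewrite eqQ (eq_law _ w ref ref').
Qed.

Lemma gibbs A (phi : W -> A) (Q : A -> R) :
  is_subdistr Q -> (forall w, 0 < P w -> 0 < Q (phi w)) ->
  expect P (fun w => ln (Q (phi w))) <= negent P phi.
Proof.
move=> Q_sub PQ.
have := kl_ge0 (law_distr P_distr phi) Q_sub (law_dominated P_distr PQ).
by rewrite kl_law_negent //; lra.
Qed.

End NegativeEntropy.

(* The reference law draws the input [i] from [mu] and then, forgetting everything about
   [i] but [h i], the observation from its conditional law. *)
Definition view_ref (W I A T : finType) (P : W -> R) (mu : I -> R) (input : W -> I)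
    (obs : W -> T) (h : I -> A) (u : I * T) : R :=
  mu u.1 * cond_law P (fun w => h (input w)) obs (h u.1) u.2.

Definition view_div (W I A T : finType) (P : W -> R) (mu : I -> R) (input : W -> I)
    (obs : W -> T) (h : I -> A) : R :=
  kl (law P (fun w => (input w, obs w))) (view_ref P mu input obs h).

Section ViewDivergence.
Variables (W I A T : finType) (P : W -> R) (mu : I -> R).
Variables (input : W -> I) (obs : W -> T) (h : I -> A).
Hypothesis P_distr : is_distr P.
Hypothesis P_mu : forall w, 0 < P w -> 0 < mu (input w).

Lemma view_ref_gt0 w : 0 < P w -> 0 < view_ref P mu input obs h (input w, obs w).
Proof.
move=> Pw; apply: Rmult_lt_0_compat; first exact: P_mu.
exact: (cond_law_gt0 P_distr (fun w => h (input w))).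
Qed.

Lemma view_ref_subdistr : is_subdistr mu -> is_subdistr (view_ref P mu input obs h).
Proof.
move=> mu_sub; pose K i := cond_law P (fun w => h (input w)) obs (h i).
by apply: (subdistr_kernel (K := K)) => // i; exact: cond_law_subdistr.
Qed.

Lemma view_div_ge0 : is_subdistr mu -> 0 <= view_div P mu input obs h.
Proof.
move=> mu_sub; apply: kl_ge0; [exact: law_distr | exact: view_ref_subdistr |].
exact/law_dominated/view_ref_gt0.
Qed.

Lemma view_divE : view_div P mu input obs h =
  negent P (fun w => (input w, obs w)) - expect P (fun w => ln (mu (input w))) -
  negent P (fun w => (h (input w), obs w)) + negent P (fun w => h (input w)).
Proof.
rewrite /view_div kl_law_negent //; last exact: view_ref_gt0.
suff -> : expect P (fun w => ln (view_ref P mu input obs h (input w, obs w))) =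
    expect P (fun w => ln (mu (input w))) +
    (negent P (fun w => (h (input w), obs w)) - negent P (fun w => h (input w))) by lra.
rewrite -expectB -expectD; apply: (eq_expect P_distr.1) => w Pw.
rewrite ln_mult; [|exact: P_mu|exact: (cond_law_gt0 P_distr (fun w => h (input w)))].
rewrite ln_div //; first exact: (law_gt0 P_distr (fun w => (h (input w), obs w))).
exact: (law_gt0 P_distr (fun w => h (input w))).
Qed.

End ViewDivergence.

Lemma view_div_swap (W X Y T : finType) (P : W -> R) (mu : X * Y -> R)
    (input : W -> X * Y) (obs : W -> T) : is_distr P ->
  view_div P mu input obs snd =
  view_div P (fun u => mu (u.2, u.1)) (fun w => ((input w).2, (input w).1)) obs fst.
Proof.
move=> P_distr; apply: eq_kl_law => // [v w [-> ->] //|v w [eq_y eq_x ->]|w].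
  by congr (_, _); exact: injective_projections.
by rewrite /view_ref /=; case: (input w).
Qed.

Lemma negent_submodular (W A B C : finType) (P : W -> R)
    (phi : W -> A) (psi : W -> B) (chi : W -> C) : is_distr P ->
  negent P (fun w => (phi w, psi w)) + negent P (fun w => (phi w, chi w)) <=
  negent P phi + negent P (fun w => (phi w, psi w, chi w)).
Proof.
move=> P_distr; pose pair w := (phi w, psi w).
have pair_gt0 : forall w, 0 < P w -> 0 < law P pair (pair w) := law_gt0 P_distr pair.
have := view_div_ge0 chi fst P_distr pair_gt0 (is_distr_subdistr (law_distr P_distr pair)).
rewrite view_divE // -[expect _ _]/(negent P pair) /pair /= -[negent P [eta phi]]/(negent P phi).
lra.
Qed.

(** * Random rectangles *)

Section RandomSelection.
Variables (Q : finType) (q : Q -> R).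
Hypothesis q_ge0 : forall i, 0 <= q i.

(* Each point [i] is selected independently with probability [1 - exp (- q i)], so
   that the probability of missing a set of points is [exp] of minus its weight. *)
Definition toss (i : Q) (selected : bool) : R :=
  if selected then 1 - exp (- q i) else exp (- q i).

Definition selection (h : {ffun Q -> bool}) : R := \prod_i toss i (h i).

Definition hits (D : pred Q) (h : {ffun Q -> bool}) : bool := [exists i, h i && D i].

Lemma toss_ge0 i b : 0 <= toss i b.
Proof.
rewrite /toss; case: b; last exact/Rlt_le/exp_pos.
have : exp (- q i) <= exp 0 by apply: exp_le_compat; have := q_ge0 i; lra.
by rewrite exp_0; lra.
Qed.

Lemma toss_true_le i : toss i true <= q i.
Proof. by rewrite /toss; have := exp_ineq1_le (- q i); lra. Qed.

Lemma toss_sum i : \sum_b toss i b = 1.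
Proof. by rewrite big_bool /toss /=; lra. Qed.

Lemma prob_selection_all (D : pred Q) (b : bool) :
  prob selection (fun h => [forall i, D i ==> (h i == b)]) = \prod_(i | D i) toss i b.
Proof.
pose S i b' := D i ==> (b' == b).
transitivity (\prod_i \sum_(b' | S i b') toss i b').
  rewrite bigA_distr_big_dep; apply: eq_bigl => h.
  by apply/forallP/familyP => all_S i; have := all_S i.
rewrite [RHS]big_mkcond; apply: eq_bigr => i _; rewrite /S.
by case: (D i) => /=; [exact: big_pred1_eq | exact: toss_sum].
Qed.

Lemma selection_distr : is_distr selection.
Proof.
split=> [h|]; first by apply: Rprod_ge0 => i _; exact: toss_ge0.
have := prob_selection_all pred0 true; rewrite big_pred0 // => <-.
by apply: eq_bigl => h; apply/esym/forallP.
Qed.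

Lemma prob_selected_pair_le i j :
  prob selection (fun h => h i && h j) <= if i == j then q i else q i * q j.
Proof.
have -> : prob selection (fun h => h i && h j) = \prod_(k | (k == i) || (k == j)) toss k true.
  rewrite -prob_selection_all; apply: eq_prob => h; apply/andP/forallP => [[hi hj] k|all_h].
    by apply/implyP => /orP[/eqP->|/eqP->]; rewrite ?hi ?hj.
  by have := all_h i; have := all_h j; rewrite !eqxx orbT /= => /eqP-> /eqP->.
case: eqP => [<-|/eqP ij].
  by rewrite (big_pred1 i) => [|k]; [exact: toss_true_le | rewrite /= orbb].
rewrite (bigD1 i) ?eqxx // (big_pred1 j) => [|k]; last first.
  by case: (k =P i) => [->|]; rewrite ?andbF ?andbT //= (negbTE ij).
by apply: Rmult_le_compat; exact: toss_ge0 || exact: toss_true_le.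
Qed.

Lemma prob_not_hits (D : pred Q) :
  prob selection (predC (hits D)) = exp (- \sum_(i | D i) q i).
Proof.
transitivity (\prod_(i | D i) toss i false).
  rewrite -prob_selection_all; apply: eq_prob => h; rewrite /= negb_exists.
  by apply: eq_forallb => i; rewrite negb_and eqbF_neg implybE orbC.
by rewrite -RsumN; elim/big_rec2: _ => [|i y1 y2 _ ->]; rewrite ?exp_0 ?exp_plus.
Qed.

Lemma prob_hits_both_ge (A B : pred Q) (K := \sum_(i | A i && B i) q i) :
  K * (1 - K) <= prob selection (fun h => hits A h && hits B h).
Proof.
have K_ge0 : 0 <= K by exact: Rsum_ge0.
apply: Rle_trans (one_sub_exp_opp_ge K_ge0) _.
pose AB i := A i && B i.
have := prob_compl (hits AB) selection_distr; rewrite prob_not_hits -/K => hitsAB.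
apply: Rle_trans (_ : prob selection (hits AB) <= _); first lra.
apply: (prob_le selection_distr.1) => h /existsP[i /and3P[hi Ai Bi]].
by apply/andP; split; apply/existsP; exists i; rewrite hi.
Qed.

Lemma prob_hits_both_le (A B : pred Q) :
  prob selection (fun h => hits A h && hits B h) <=
  \sum_(i | A i && B i) q i + (\sum_(i | A i) q i) * (\sum_(j | B j) q j).
Proof.
pose both i j (h : {ffun Q -> bool}) : R := if h i && h j then 1 else 0.
have both_ge0 i j h : 0 <= both i j h by rewrite /both; case: ifP; lra.
apply: Rle_trans (_ : _ <= \sum_(i | A i) \sum_(j | B j) expect selection (both i j)) _.
  under eq_bigr => i _ do rewrite -expect_sum.
  rewrite -expect_sum -expect_ind; apply: (le_expect selection_distr.1) => h _.
  case: ifP => [/andP[/existsP[i /andP[hi Ai]] /existsP[j /andP[hj Bj]]]|_]; last first.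
    by do 2![apply: Rsum_ge0 => ? _].
  have -> : 1 = both i j h by rewrite /both hi hj.
  apply: Rle_trans (_ : \sum_(j | B j) both i j h <= _).
    exact: (Rsum_ge_term (F := fun j => both i j h)).
  apply: (Rsum_ge_term (F := fun i => \sum_(j | B j) both i j h)) => // k _.
  exact: Rsum_ge0.
rewrite Rmult_suml big_mkcondr -big_split; apply: Rsum_le => i _ /=; rewrite Rmult_sumr.
have -> : (if B i then q i else 0) = \sum_(j | B j) (if i == j then q i else 0).
  rewrite big_mkcond (bigD1 i) //= eqxx big1 ?Rplus_0_r // => j /negbTE ji.
  by rewrite eq_sym ji if_same.
rewrite -big_split; apply: Rsum_le => j _ /=.
rewrite /both expect_ind; apply: Rle_trans (prob_selected_pair_le i j) _.
by have := Rmult_le_pos _ _ (q_ge0 i) (q_ge0 j); case: ifP; lra.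
Qed.

End RandomSelection.

Definition rect_dense (X Y : finType) (mu : X * Y -> R) (E : pred (X * Y))
    (eta sigma : R) : Prop :=
  forall AB, sigma < prob mu (in_rect AB) ->
    eta * prob mu (in_rect AB) < prob mu (fun u => in_rect AB u && E u).

Section RectDense.
Variables (X Y : finType) (mu : X * Y -> R) (E : pred (X * Y)) (eta sigma : R).
Hypothesis dense : rect_dense mu E eta sigma.

Lemma rect_dense_linear AB : (forall u, 0 <= mu u) -> 0 <= eta -> 0 <= sigma ->
  eta * (prob mu (in_rect AB) - sigma) <= prob mu (fun u => in_rect AB u && E u).
Proof.
move=> mu_ge0 eta_ge0 sigma_ge0; case: (Rlt_le_dec sigma (prob mu (in_rect AB))) => [/dense|small].
  by nra.
by apply: Rle_trans (prob_ge0 mu_ge0 _); nra.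
Qed.

Lemma rect_dense_lt1 : is_distr mu -> sigma < 1 -> eta < 1.
Proof.
move=> mu_distr sigma_lt1; have full : prob mu (in_rect ([set: X], [set: Y])) = 1.
  by rewrite -mu_distr.2; apply: eq_bigl => u; rewrite /in_rect !inE.
have := @dense (setT, setT); rewrite full Rmult_1_r => /(_ sigma_lt1) eta_lt.
by apply: Rlt_le_trans eta_lt _; exact: prob_distr_le1.
Qed.

End RectDense.

Section RandomRectangles.
Variables (X Y Q : finType) (q : Q -> R) (a : Q -> X -> bool) (b : Q -> Y -> bool) (L : R).
Hypothesis q_ge0 : forall i, 0 <= q i.
Hypothesis a_le : forall x, \sum_(i | a i x) q i <= L.
Hypothesis b_le : forall y, \sum_(i | b i y) q i <= L.

Definition rect_of (h : {ffun Q -> bool}) : {set X} * {set Y} :=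
  ([set x | hits (a^~ x) h], [set y | hits (b^~ y) h]).

Definition rect_kernel (u : X * Y) : R := \sum_(i | a i u.1 && b i u.2) q i.

Lemma prob_in_rect_of u : prob (selection q) (fun h => in_rect (rect_of h) u) =
  prob (selection q) (fun h => hits (a^~ u.1) h && hits (b^~ u.2) h).
Proof. by apply: eq_prob => h; rewrite /in_rect !inE. Qed.

Lemma prob_in_rect_of_ge u :
  (1 - L) * rect_kernel u <= prob (selection q) (fun h => in_rect (rect_of h) u).
Proof.
rewrite prob_in_rect_of; apply: Rle_trans (prob_hits_both_ge q_ge0 _ _).
rewrite -/(rect_kernel u).
have K_ge0 : 0 <= rect_kernel u by exact: Rsum_ge0.
have : rect_kernel u <= L; last by nra.
by apply: Rle_trans (a_le u.1); apply: Rsum_le_subpred => // i /andP[].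
Qed.

Lemma prob_in_rect_of_le u :
  prob (selection q) (fun h => in_rect (rect_of h) u) <= rect_kernel u + L * L.
Proof.
rewrite prob_in_rect_of; apply: Rle_trans (prob_hits_both_le q_ge0 _ _) _.
by apply: Rplus_le_compat_l; apply: Rmult_le_compat => //; exact: Rsum_ge0.
Qed.

Lemma expect_prob_rect_of (mu : X * Y -> R) (F : pred (X * Y)) :
  expect (selection q) (fun h => prob mu (fun u => in_rect (rect_of h) u && F u)) =
  \sum_(u | F u) mu u * prob (selection q) (fun h => in_rect (rect_of h) u).
Proof.
under [RHS]eq_bigr => u _ do rewrite -expect_ind Rmult_sumr.
rewrite exchange_big; apply: eq_bigr => h _; rewrite Rmult_sumr big_mkcondl /=.
by apply: eq_bigr => u _; case: ifP; lra.
Qed.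

Lemma random_rectangle (mu : X * Y -> R) (E : pred (X * Y)) (eta sigma : R) :
  is_distr mu -> 0 <= eta -> 0 <= sigma -> rect_dense mu E eta sigma ->
  eta * ((1 - L) * expect mu rect_kernel - sigma) <=
  \sum_(u | E u) mu u * rect_kernel u + L * L.
Proof.
move=> mu_distr eta_ge0 sigma_ge0 dense; have sel_distr := selection_distr q_ge0.
have avg : eta * (expect (selection q) (fun h => prob mu (in_rect (rect_of h))) - sigma) <=
    expect (selection q) (fun h => prob mu (fun u => in_rect (rect_of h) u && E u)).
  rewrite -(expect_const sigma sel_distr) -expectB Rmult_sumr; apply: Rsum_le => h _.
  rewrite -Rmult_assoc (Rmult_comm eta) Rmult_assoc.
  apply: Rmult_le_compat_l; first exact: sel_distr.1.
  exact: rect_dense_linear mu_distr.1 eta_ge0 sigma_ge0.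
have lower : (1 - L) * expect mu rect_kernel <=
    expect (selection q) (fun h => prob mu (in_rect (rect_of h))).
  apply: Rle_trans (_ : \sum_u mu u * prob (selection q) (fun h => in_rect (rect_of h) u) <= _).
    rewrite Rmult_sumr; apply: Rsum_le => u _.
    rewrite -Rmult_assoc (Rmult_comm (1 - L)) Rmult_assoc.
    by apply: Rmult_le_compat_l; [exact: mu_distr.1 | exact: prob_in_rect_of_ge].
  rewrite -(expect_prob_rect_of mu xpredT); apply: Req_le; apply: eq_bigr => h _.
  by congr (_ * _); apply: eq_prob => u; rewrite andbT.
have upper : expect (selection q) (fun h => prob mu (fun u => in_rect (rect_of h) u && E u)) <=
    \sum_(u | E u) mu u * rect_kernel u + L * L.
  rewrite expect_prob_rect_of.
  apply: Rle_trans (_ : _ <= \sum_(u | E u) (mu u * rect_kernel u + mu u * (L * L))) _.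
    apply: Rsum_le => u _; rewrite -Rmult_plus_distr_l.
    by apply: Rmult_le_compat_l; [exact: mu_distr.1 | exact: prob_in_rect_of_le].
  rewrite big_split -Rmult_suml /=; apply: Rplus_le_compat_l.
  rewrite -[X in _ <= X]Rmult_1_l; apply: Rmult_le_compat_r; first exact: Rle_0_sqr.
  exact: prob_distr_le1.
have := Rmult_le_compat_l eta _ _ eta_ge0 lower; lra.
Qed.

End RandomRectangles.

Lemma random_rectangle_scaled (X Y Q : finType) (q : Q -> R) (a : Q -> X -> bool)
    (b : Q -> Y -> bool) (L p : R) (mu : X * Y -> R) (E : pred (X * Y)) (eta sigma : R) :
  (forall i, 0 <= q i) -> (forall x, \sum_(i | a i x) q i <= L) ->
  (forall y, \sum_(i | b i y) q i <= L) -> 0 < p ->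
  is_distr mu -> 0 <= eta -> 0 <= sigma -> rect_dense mu E eta sigma ->
  eta * ((1 - p * L) * expect mu (rect_kernel q a b) - sigma / p) <=
  \sum_(u | E u) mu u * rect_kernel q a b u + p * L * L.
Proof.
move=> q_ge0 a_le b_le p_gt0 mu_distr eta_ge0 sigma_ge0 dense; pose pq i := p * q i.
have pq_ge0 i : 0 <= pq i by apply: Rmult_le_pos => //; lra.
have pq_sum (D : pred Q) : \sum_(i | D i) pq i = p * \sum_(i | D i) q i by rewrite Rmult_sumr.
have pq_le D : \sum_(i | D i) q i <= L -> \sum_(i | D i) pq i <= p * L.
  by move=> le_L; rewrite pq_sum; apply: Rmult_le_compat_l => //; lra.
have := random_rectangle pq_ge0 (fun x => pq_le _ (a_le x)) (fun y => pq_le _ (b_le y))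
  mu_distr eta_ge0 sigma_ge0 dense.
have kernel_scale u : mu u * rect_kernel pq a b u = p * (mu u * rect_kernel q a b u).
  by rewrite /rect_kernel pq_sum; lra.
rewrite {1}/expect !(eq_bigr _ (fun u _ => kernel_scale u)) -!Rmult_sumr.
rewrite -[\sum_u _]/(expect mu (rect_kernel q a b)).
set mass := expect _ _; set mass_E := \sum_(u | E u) _ => bound.
apply: (Rmult_le_reg_l p) => //.
have -> : p * (eta * ((1 - p * L) * mass - sigma / p)) =
    eta * ((1 - p * L) * (p * mass) - sigma) by field; lra.
by apply: Rle_trans bound _; rewrite -/mass_E; lra.
Qed.

(** * Sampling the transcript without communication *)

Lemma sum_gaps_le (n k : nat) (level : nat -> R) :
  (forall i j, (i <= j <= n)%N -> level i <= level j) -> (k <= n)%N ->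
  \sum_(i < n | Rleb (level i.+1) (level k)) (level i.+1 - level i) = level k - level 0%N.
Proof.
move=> level_le kn; have gap_ge0 (i : 'I_n) : level i <= level i.+1.
  by apply: level_le; rewrite leqnSn ltn_ord.
transitivity (Rmin (level n) (level k) - Rmin (level 0%N) (level k)); last first.
  by rewrite Rmin_right ?Rmin_left //; apply: level_le; rewrite ?kn ?leqnn.
rewrite -(Rsum_telescope n (fun i => Rmin (level i) (level k))) big_mkcond.
apply: eq_bigr => i _; have := gap_ge0 i; have [ki|ik] := leqP k i => gap_i.
  have ? : level k <= level i by apply: level_le; rewrite ki ltnW.
  by rewrite !Rmin_right; try lra; case: RlebP => //; lra.
have ? : level i.+1 <= level k by apply: level_le; rewrite ik.
by rewrite !Rmin_left; try lra; case: RlebP => //; lra.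
Qed.

Lemma layer_cake (V : finType) (h : V -> R) : (forall v, 0 <= h v) ->
  exists (n : nat) (w : 'I_n -> R) (S : 'I_n -> pred V), (forall i, 0 <= w i) /\
    forall u v, \sum_(i | S i u && S i v) w i = Rmin (h u) (h v).
Proof.
move=> h_ge0; pose s := sort (relpre h Rleb) (enum V).
pose level := nth 0 (0 :: map h s); pose n := size s.
have level_sorted : sorted Rleb (0 :: map h s).
  rewrite /= (path_sortedE Rleb_trans) sorted_map sort_sorted => [|u v]; last exact: Rleb_total.
  by rewrite andbT all_map; apply/allP => v _; exact/RlebP.
have level_le i j : (i <= j <= n)%N -> level i <= level j.
  move=> /andP[ij jn]; apply/RlebP; apply: (sorted_leq_nth Rleb_trans Rleb_refl) => //;
    by rewrite inE /= size_map ltnS // (leq_trans ij).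
have layers_below v : \sum_(i < n | Rleb (level i.+1) (h v)) (level i.+1 - level i) = h v.
  have vs : v \in s by rewrite mem_sort mem_enum.
  have -> : h v = level (index v s).+1 by rewrite /level /= (nth_map v) ?index_mem // nth_index.
  by rewrite sum_gaps_le ?index_mem // /level /=; lra.
exists n, (fun i => level i.+1 - level i), (fun i v => Rleb (level i.+1) (h v)).
split=> [i|u v].
  by have : level i <= level i.+1; [apply: level_le; rewrite leqnSn ltn_ord | lra].
by rewrite /Rmin; case: Rle_dec => huv; rewrite -[RHS]layers_below;
  apply: eq_bigl => i; case: RlebP => ?; case: RlebP => ? //=; lra.
Qed.

Lemma min_product_layers (T V : finType) (D : pred T) (alpha beta : T -> V -> R) :
  (forall o v, 0 <= alpha o v) -> (forall o v, 0 <= beta o v) ->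
  exists (Q : finType) (q : Q -> R) (S : Q -> pred V), (forall i, 0 <= q i) /\
    forall u v, \sum_(i | S i u && S i v) q i =
      \sum_(o | D o) Rmin (alpha o u) (alpha o v) * Rmin (beta o u) (beta o v).
Proof.
move=> alpha_ge0 beta_ge0.
have [n [w [S [w_ge0 SE]]]] := layer_cake (fun p : T * V => alpha_ge0 p.1 p.2).
have [n' [w' [S' [w'_ge0 S'E]]]] := layer_cake (fun p : T * V => beta_ge0 p.1 p.2).
exists (T * ('I_n * 'I_n'))%type, (fun l => w l.2.1 * w' l.2.2),
  (fun l v => [&& D l.1, S l.2.1 (l.1, v) & S' l.2.2 (l.1, v)]).
split=> [l|u v]; first exact: Rmult_le_pos.
rewrite big_mkcond Rsum_pair [RHS]big_mkcond; apply: eq_bigr => o _ /=.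
case: (D o) => /=; last by rewrite big1.
rewrite -(SE (o, u) (o, v)) -(S'E (o, u) (o, v)) big_distrlr pair_big -big_mkcond /=.
by apply: eq_bigl => -[i j]; exact: andbACA.
Qed.

(* [uA o x * uB o y] is the density of the transcript [o], of which Alice knows only the
   first factor and Bob only the second one.  Alice's guess [L * viewA x o / uA o x] for
   Bob's factor comes from the probability [viewA x o] that [o] has in her view. *)
Section ZeroCommunication.
Variables (X Y T : finType) (uA : T -> X -> R) (uB : T -> Y -> R).
Variables (viewA : X -> T -> R) (viewB : Y -> T -> R) (L : R).
Hypothesis uA_ge0 : forall o x, 0 <= uA o x.
Hypothesis uB_ge0 : forall o y, 0 <= uB o y.
Hypothesis viewA_subdistr : forall x, is_subdistr (viewA x).
Hypothesis viewB_subdistr : forall y, is_subdistr (viewB y).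
Hypothesis L_gt0 : 0 < L.

Definition density (u : X * Y) (o : T) : R := uA o u.1 * uB o u.2.

Definition acceptable (u : X * Y) (o : T) : bool :=
  Rleb (density u o) (L * viewA u.1 o) && Rleb (density u o) (L * viewB u.2 o).

Definition guess (own view : R) : R := L * (view / own).

Definition sampled_density (u : X * Y) (o : T) : R :=
  Rmin (uA o u.1) (guess (uB o u.2) (viewB u.2 o)) *
  Rmin (guess (uA o u.1) (viewA u.1 o)) (uB o u.2).

Lemma guess_ge0 own view : 0 <= own -> 0 <= view -> 0 <= guess own view.
Proof. by move=> *; apply: Rmult_le_pos; [exact: Rlt_le | exact: Rdiv_ge0]. Qed.

Lemma mult_guess_le own view : 0 <= view -> own * guess own view <= L * view.
Proof.
move=> view_ge0; have -> : own * guess own view = L * (own * (view / own)) by rewrite /guess; lra.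
by apply: Rmult_le_compat_l; [exact: Rlt_le | exact: Rmult_div_le].
Qed.

Lemma le_guess own other view : 0 < own -> own * other <= L * view -> other <= guess own view.
Proof.
move=> own_gt0 le_view; apply: (Rmult_le_reg_l own) => //.
by have -> : own * guess own view = L * view by rewrite /guess; field; lra.
Qed.

Lemma sampled_density_ge0 u o : 0 <= sampled_density u o.
Proof.
by apply: Rmult_le_pos; apply: Rmin_glb => //; apply: guess_ge0 => //;
  [exact: (viewB_subdistr _).1 | exact: (viewA_subdistr _).1].
Qed.

Lemma sampled_density_le u o : sampled_density u o <= density u o.
Proof.
apply: Rmult_le_compat; [| |exact: Rmin_l|exact: Rmin_r]; apply: Rmin_glb => //;
  apply: guess_ge0 => //; [exact: (viewB_subdistr _).1 | exact: (viewA_subdistr _).1].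
Qed.

Lemma acceptable_sampled_density u o : acceptable u o -> density u o <= sampled_density u o.
Proof.
move=> /andP[/RlebP leA /RlebP leB]; have := sampled_density_ge0 u o; rewrite /density in leA leB *.
case: (Rle_lt_or_eq_dec _ _ (uA_ge0 o u.1)) => [a_gt0|<-]; last by rewrite Rmult_0_l.
case: (Rle_lt_or_eq_dec _ _ (uB_ge0 o u.2)) => [b_gt0|<-]; last by rewrite Rmult_0_r.
rewrite /sampled_density Rmin_left; last by apply: le_guess; rewrite // Rmult_comm.
by rewrite Rmin_right; [move=> _; exact: Rle_refl | exact: le_guess].
Qed.

Lemma sampled_density_rects (accept : pred T) :
  exists (Q : finType) (q : Q -> R) (a : Q -> X -> bool) (b : Q -> Y -> bool),
  [/\ forall i, 0 <= q i,
      forall x, \sum_(i | a i x) q i <= L,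
      forall y, \sum_(i | b i y) q i <= L &
      forall u, rect_kernel q a b u = \sum_(o | accept o) sampled_density u o].
Proof.
pose alpha o (v : X + Y) := match v with inl x => uA o x | inr y => guess (uB o y) (viewB y o) end.
pose beta o (v : X + Y) := match v with inl x => guess (uA o x) (viewA x o) | inr y => uB o y end.
have viewA_ge0 x o := (viewA_subdistr x).1 o; have viewB_ge0 y o := (viewB_subdistr y).1 o.
have [||Q [q [S [q_ge0 SE]]]] := @min_product_layers T (X + Y)%type accept alpha beta.
- by move=> o [x|y] //=; exact: guess_ge0.
- by move=> o [x|y] //=; exact: guess_ge0.
have diag v : \sum_(i | S i v) q i = \sum_(o | accept o) alpha o v * beta o v.
  have := SE v v; under eq_bigl => i do rewrite andbb.
  by move=> ->; apply: eq_bigr => o _; rewrite !Rmin_left //; exact: Rle_refl.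
have sum_view_le (V : T -> R) : is_subdistr V -> \sum_(o | accept o) L * V o <= L.
  case=> V_ge0 V_sum; rewrite -Rmult_sumr -[X in _ <= X]Rmult_1_r.
  apply: Rmult_le_compat_l; first exact: Rlt_le.
  by apply: Rle_trans V_sum; exact: Rsum_le_subpred.
exists Q, q, (fun i x => S i (inl x)), (fun i y => S i (inr y)); split=> // [x|y|u].
- rewrite diag; apply: Rle_trans (sum_view_le _ (viewA_subdistr x)).
  by apply: Rsum_le => o _; exact: mult_guess_le.
- rewrite diag; apply: Rle_trans (sum_view_le _ (viewB_subdistr y)).
  by apply: Rsum_le => o _; rewrite Rmult_comm; exact: mult_guess_le.
- exact: SE.
Qed.

Lemma zero_communication (mu : X * Y -> R) (E : pred (X * Y)) (accept : pred T)
    (eta sigma err : R) :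
  is_distr mu -> 0 <= eta -> 0 <= sigma -> rect_dense mu E eta sigma ->
  0 < err -> err <= L ->
  eta * ((1 - err / L) *
           (\sum_u mu u * \sum_(o | accept o && acceptable u o) density u o) -
         sigma * (L * L) / err) <=
  \sum_(u | E u) mu u * (\sum_(o | accept o) density u o) + err.
Proof.
move=> mu_distr eta_ge0 sigma_ge0 dense err_gt0 err_le.
have [Q [q [a [b [q_ge0 a_le b_le kernelE]]]]] := sampled_density_rects accept.
pose p := err / (L * L); have p_gt0 : 0 < p by apply: Rdiv_lt_0_compat => //; nra.
have := random_rectangle_scaled q_ge0 a_le b_le p_gt0 mu_distr eta_ge0 sigma_ge0 dense.
have -> : p * L = err / L by rewrite /p; field; lra.
have -> : sigma / p = sigma * (L * L) / err by rewrite /p; field; lra.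
have -> : err / L * L = err by field; lra.
move=> bound; apply: Rle_trans (Rle_trans _ _ _ _ bound) _; last first.
  apply: Rplus_le_compat_r; apply: Rsum_le => u _; apply: Rmult_le_compat_l.
    exact: mu_distr.1.
  by rewrite kernelE; apply: Rsum_le => o _; exact: sampled_density_le.
apply: Rmult_le_compat_l => //; apply: Rplus_le_compat_r; apply: Rmult_le_compat_l.
  by suff : err / L <= 1 by [lra]; apply/Rle_div_l; lra.
apply: Rsum_le => u _; apply: Rmult_le_compat_l; first exact: mu_distr.1.
rewrite kernelE big_mkcondr; apply: Rsum_le => o _; case: ifP => [|_].
  exact: acceptable_sampled_density.
exact: sampled_density_ge0.
Qed.

End ZeroCommunication.

Section SingleCopy.
Variables (X Y T W : finType) (P : W -> R) (mu : X * Y -> R).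
Variables (input : W -> X * Y) (obs : W -> T) (uA : T -> X -> R) (uB : T -> Y -> R).
Hypothesis P_distr : is_distr P.
Hypothesis mu_distr : is_distr mu.
Hypothesis uA_ge0 : forall o x, 0 <= uA o x.
Hypothesis uB_ge0 : forall o y, 0 <= uB o y.

Local Notation joint := (law P (fun w => (input w, obs w))).
Local Notation viewA := (cond_law P (fun w => (input w).1) obs).
Local Notation viewB := (cond_law P (fun w => (input w).2) obs).

Hypothesis joint_factor : forall u o, joint (u, o) = mu u * density uA uB u o.

Lemma factor_support w : 0 < P w -> 0 < mu (input w).
Proof.
move=> Pw; have := law_gt0 P_distr (fun w => (input w, obs w)) Pw; rewrite joint_factor.
by case: (mu_distr.1 (input w)) => // <-; rewrite Rmult_0_l; lra.
Qed.

Lemma sum_density (D : pred (X * Y)) (G : X * Y -> T -> bool) :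
  \sum_(u | D u) mu u * (\sum_(o | G u o) density uA uB u o) =
  prob joint (fun p => D p.1 && G p.1 p.2).
Proof.
rewrite /prob -(pair_big_dep D G (fun u o => joint (u, o))) /=.
by apply: eq_bigr => u _; rewrite Rmult_sumr; apply: eq_bigr => o _; rewrite joint_factor.
Qed.

Lemma prob_acceptable_ge (accept : pred T) (s : R) : 1 < s ->
  prob P (fun w => accept (obs w)) -
    (view_div P mu input obs fst + view_div P mu input obs snd) / (s - 1) <=
  prob joint (fun p => accept p.2 && acceptable uA uB viewA viewB (exp s) p.1 p.2).
Proof.
move=> s_gt1; rewrite -(prob_law P (fun w => (input w, obs w)) (fun p => accept p.2)).
have joint_distr := law_distr P_distr (fun w => (input w, obs w)).
have tail (A : finType) (h : X * Y -> A) :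
    (s - 1) * prob joint (fun p => ~~ Rleb (joint p) (exp s * view_ref P mu input obs h p)) <=
    view_div P mu input obs h.
  apply: kl_tail => //; first exact: view_ref_subdistr (is_distr_subdistr mu_distr).
  by apply: law_dominated => // w Pw; apply: view_ref_gt0 => // v; exact: factor_support.
have tail_fst := tail _ fst; have tail_snd := tail _ snd.
set tA := prob _ _ in tail_fst; set tB := prob _ _ in tail_snd.
set dA := view_div _ _ _ _ fst in tail_fst *; set dB := view_div _ _ _ _ snd in tail_snd *.
have tails : tA + tB <= (dA + dB) / (s - 1) by apply/Rle_div_r; lra.
suff : prob joint (fun p => accept p.2) <=
  prob joint (fun p => accept p.2 && acceptable uA uB viewA viewB (exp s) p.1 p.2) + (tA + tB).
  by lra.
have tails_union :
    prob joint (fun p => ~~ Rleb (joint p) (exp s * view_ref P mu input obs fst p) ||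
                         ~~ Rleb (joint p) (exp s * view_ref P mu input obs snd p)) <= tA + tB.
  by apply: (prob_union_le joint_distr.1).
apply: Rle_trans (prob_union_le joint_distr.1 _) (Rplus_le_compat_l _ _ _ tails_union).
move=> [u o] joint_gt0 /= o_accept; rewrite o_accept /= -negb_and orbC -implybE.
have mu_gt0 : 0 < mu u.
  by move: joint_gt0; rewrite joint_factor; case: (mu_distr.1 u) => // <-; lra.
have unscale v : Rleb (mu u * density uA uB u o) (exp s * (mu u * v)) =
    Rleb (density uA uB u o) (exp s * v).
  by apply/RlebP/RlebP => ?; [apply: (Rmult_le_reg_l (mu u)) | ]; nra.
by rewrite joint_factor /view_ref /= !unscale; apply/implyP.
Qed.

Lemma single_copy (E : pred (X * Y)) (accept : pred T) (eta sigma s err : R) :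
  0 <= eta -> 0 <= sigma -> rect_dense mu E eta sigma -> 1 < s ->
  0 < err -> err <= exp s ->
  eta * ((1 - err / exp s) *
           (prob P (fun w => accept (obs w)) -
            (view_div P mu input obs fst + view_div P mu input obs snd) / (s - 1)) -
         sigma * (exp s * exp s) / err) <=
  prob P (fun w => E (input w) && accept (obs w)) + err.
Proof.
move=> eta_ge0 sigma_ge0 dense s_gt1 err_gt0 err_le; have L_gt0 := exp_pos s.
have := zero_communication uA_ge0 uB_ge0 (cond_law_subdistr P_distr (fun w => (input w).1) obs)
  (cond_law_subdistr P_distr (fun w => (input w).2) obs) L_gt0 accept
  mu_distr eta_ge0 sigma_ge0 dense err_gt0 err_le.
rewrite (sum_density xpredT) (sum_density E (fun _ => accept)).
rewrite (prob_law _ _ (fun p => E p.1 && accept p.2)) => bound.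
apply: Rle_trans bound; apply: Rmult_le_compat_l => //; apply: Rplus_le_compat_r.
apply: Rmult_le_compat_l; last exact: prob_acceptable_ge.
by suff : err / exp s <= 1 by [lra]; apply/Rle_div_l; lra.
Qed.

End SingleCopy.

(** * Product laws and the chain rule *)

Definition coord (X Y : Type) (t : nat) (i : 'I_t) (w : {ffun 'I_t -> X} * {ffun 'I_t -> Y}) :
  X * Y := (w.1 i, w.2 i).

Definition prod_law (X Y : finType) (t : nat) (F : 'I_t -> X * Y -> R)
    (w : {ffun 'I_t -> X} * {ffun 'I_t -> Y}) : R :=
  \prod_i F i (coord i w).

Lemma uniform_distr (M : finType) : 0 < INR #|M| -> is_distr (fun _ : M => / INR #|M|).
Proof.
move=> M_gt0; split=> [_|]; first exact/Rlt_le/Rinv_0_lt_compat.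
by rewrite Rsum_const; apply: Rinv_r; exact: Rgt_not_eq.
Qed.

Section ProductLaw.
Variables (X Y : finType) (t : nat).
Local Notation inputs := ({ffun 'I_t -> X} * {ffun 'I_t -> Y})%type.

Lemma prod_law_distr (F : 'I_t -> X * Y -> R) :
  (forall i, is_distr (F i)) -> is_distr (prod_law F).
Proof.
move=> F_distr; split=> [w|]; first by apply: Rprod_ge0 => i _; exact: (F_distr i).1.
rewrite Rsum_pair /prod_law /coord /=.
transitivity (\sum_(x : {ffun 'I_t -> X}) \prod_(i : 'I_t) \sum_y F i (x i, y)).
  by apply: eq_bigr => x _; rewrite bigA_distr_bigA.
rewrite -(bigA_distr_bigA (fun i x => \sum_y F i (x, y))) big1 // => i _.
by rewrite -Rsum_pair (F_distr i).2.
Qed.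

Section Observable.
Variables (W : finType) (P : W -> R) (phi : W -> inputs).
Hypothesis P_distr : is_distr P.

Lemma prod_law_gt0 (F : 'I_t -> X * Y -> R) w :
  (forall i, 0 < F i (coord i (phi w))) -> 0 < prod_law F (phi w).
Proof. by move=> F_gt0; apply: Rprod_gt0 => i _; exact: F_gt0. Qed.

Lemma expect_ln_prod_law (F : 'I_t -> X * Y -> R) :
  (forall w, 0 < P w -> forall i, 0 < F i (coord i (phi w))) ->
  expect P (fun w => ln (prod_law F (phi w))) =
  \sum_i expect P (fun w => ln (F i (coord i (phi w)))).
Proof.
move=> F_gt0; rewrite -expect_sum; apply: (eq_expect P_distr.1) => w Pw.
by rewrite ln_prod // => i _; exact: F_gt0.
Qed.

Lemma kl_prod_law_superadditive (mu : X * Y -> R) :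
  (forall w, 0 < P w -> forall i, 0 < mu (coord i (phi w))) ->
  \sum_i kl (law P (fun w => coord i (phi w))) mu <= kl (law P phi) (prod_law (fun _ => mu)).
Proof.
move=> P_mu; pose margin i := law P (fun w => coord i (phi w)).
have margin_distr i : is_distr (margin i) by exact: law_distr.
have margin_gt0 w : 0 < P w -> forall i, 0 < margin i (coord i (phi w)).
  by move=> Pw i; exact: (law_gt0 P_distr (fun w => coord i (phi w))).
have := gibbs P_distr (is_distr_subdistr (prod_law_distr margin_distr))
  (fun w Pw => prod_law_gt0 (margin_gt0 w Pw)).
rewrite expect_ln_prod_law // kl_law_negent //; last by move=> w /P_mu; exact: prod_law_gt0.
rewrite expect_ln_prod_law // => gibbs_margins.
rewrite (eq_bigr (fun i => negent P (fun w => coord i (phi w)) -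
    expect P (fun w => ln (mu (coord i (phi w)))))) => [|i _]; last first.
  by rewrite kl_law_negent // => w /P_mu.
by rewrite RsumB; apply: Rplus_le_compat_r.
Qed.

Lemma gibbs_prod_law (M : finType) (m : W -> M) (F : 'I_t -> X * Y -> R) :
  (forall i, is_distr (F i)) -> (forall w, 0 < P w -> forall i, 0 < F i (coord i (phi w))) ->
  \sum_i expect P (fun w => ln (F i (coord i (phi w)))) - ln (INR #|M|) <=
  negent P (fun w => (phi w, m w)).
Proof.
move=> F_distr F_gt0.
have M_gt0 : 0 < INR #|M| by have [w] := distr_inhabited P_distr; exact: INR_card_gt0 (m w).
have invM_gt0 : 0 < / INR #|M| by exact: Rinv_0_lt_compat.
have prod_gt0 w : 0 < P w -> 0 < prod_law F (phi w) by move=> /F_gt0; exact: prod_law_gt0.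
pose q (u : inputs * M) := prod_law F u.1 * / INR #|M|.
have q_subdistr : is_subdistr q.
  apply: (subdistr_kernel (K := fun _ _ => / INR #|M|)) => [|_]; apply: is_distr_subdistr.
    exact: prod_law_distr.
  exact: uniform_distr.
apply: Rle_trans (gibbs (phi := fun w => (phi w, m w)) P_distr q_subdistr _); last first.
  by move=> w /prod_gt0 ?; exact: Rmult_lt_0_compat.
rewrite -expect_ln_prod_law // -(expect_const (ln _) P_distr) -expectB; apply: Req_le.
apply: (eq_expect P_distr.1) => w /prod_gt0 ?.
by rewrite /q /= ln_mult // ln_Rinv.
Qed.

End Observable.
End ProductLaw.

Definition keep_on (t : nat) (V : finType) (v0 : V) (S : {set 'I_t}) (v : {ffun 'I_t -> V}) :
  {ffun 'I_t -> V} := [ffun i => if i \in S then v i else v0].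

Lemma keep_onP (t : nat) (V : finType) (v0 : V) (S : {set 'I_t}) (v v' : {ffun 'I_t -> V}) :
  keep_on v0 S v = keep_on v0 S v' <-> {in S, v =1 v'}.
Proof.
split=> [/ffunP eq_keep i iS|eq_on]; first by have := eq_keep i; rewrite !ffunE iS.
by apply/ffunP => i; rewrite !ffunE; case: ifP => // /eq_on.
Qed.

Section ChainRule.
Variables (W X Y M T : finType) (t : nat) (P : W -> R) (mu : X * Y -> R) (y0 : Y).
Variables (phi : W -> {ffun 'I_t -> X} * {ffun 'I_t -> Y}) (m : W -> M).
Variables (C : {set 'I_t}) (B : 'I_t -> {set 'I_t}) (obs : 'I_t -> W -> T).
Hypothesis P_distr : is_distr P.
Hypothesis mu_distr : is_distr mu.
Hypothesis P_mu : forall w, 0 < P w -> forall i, 0 < mu (coord i (phi w)).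

Definition partial (S : {set 'I_t}) (w : W) : {ffun 'I_t -> X} * {ffun 'I_t -> Y} * M :=
  ((phi w).1, keep_on y0 S (phi w).2, m w).

Hypothesis partial_refines_obs : forall j, refines (partial (B j)) (obs j).
Hypothesis obs_refines : forall j, refines (obs j) (fun w => (keep_on y0 (B j) (phi w).2, m w)).
Hypothesis B_telescope : forall G : {set 'I_t} -> R,
  \sum_(j | j \notin C) (G (j |: B j) - G (B j)) = G setT - G C.

Local Notation mean_ln j := (expect P (fun w => ln (mu (coord j (phi w))))).

Lemma chain_step j :
  negent P (fun w => (coord j (phi w), obs j w)) - negent P (fun w => ((phi w).1 j, obs j w)) <=
  negent P (partial (j |: B j)) - negent P (partial (B j)).
Proof.
have eq_joint : negent P (fun w => ((phi w).1 j, obs j w, (phi w).2 j)) =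
    negent P (fun w => (coord j (phi w), obs j w)).
  by apply: eq_negent => // v w; rewrite /coord => -[-> -> ->].
have eq_before : negent P (fun w => ((phi w).1 j, obs j w, (phi w).1)) = negent P (partial (B j)).
  apply: eq_negent => // v w => [[_ /obs_refines[eq_B eq_m] eq_x]|eq_part].
    by rewrite /partial eq_B eq_m eq_x.
  by rewrite (partial_refines_obs eq_part); case: eq_part => eq_x _ _; rewrite /coord /= eq_x.
have eq_after : negent P (fun w => ((phi w).1 j, obs j w, (phi w).2 j, (phi w).1)) =
    negent P (partial (j |: B j)).
  apply: eq_negent => // v w.
    move=> [_ /obs_refines[/keep_onP eq_B eq_m] eq_y eq_x].
    rewrite /partial eq_x eq_m; congr (_, _, _); apply/keep_onP => i.
    by rewrite in_setU1 => /orP[/eqP->|/eq_B].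
  move=> [eq_x /keep_onP eq_jB eq_m]; have eq_part : partial (B j) v = partial (B j) w.
    rewrite /partial eq_x eq_m; congr (_, _, _); apply/keep_onP => i iB.
    by apply: eq_jB; rewrite setU1r.
  by rewrite (partial_refines_obs eq_part) /coord eq_x eq_jB // setU11.
suff : negent P (fun w => (coord j (phi w), obs j w)) + negent P (partial (B j)) <=
    negent P (fun w => ((phi w).1 j, obs j w)) + negent P (partial (j |: B j)) by lra.
rewrite -eq_joint -eq_before -eq_after.
exact: (negent_submodular (fun w => ((phi w).1 j, obs j w)) _ _ P_distr).
Qed.

Lemma negent_partial_ge :
  \sum_(j | j \in C) mean_ln j + \sum_(j | j \notin C) negent P (fun w => (phi w).1 j) -
    ln (INR #|M|) <= negent P (partial C).
Proof.
pose x_law i := law P (fun w => (phi w).1 i).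
pose F i (u : X * Y) := if i \in C then mu u else if u.2 == y0 then x_law i u.1 else 0.
have F_distr i : is_distr (F i).
  rewrite /F; case: (i \in C) => //.
  have [law_ge0 law_sum] := law_distr P_distr (fun w => (phi w).1 i).
  split=> [u|]; first by case: ifP => _; [exact: law_ge0 | exact: Rle_refl].
  rewrite Rsum_pair -law_sum; apply: eq_bigr => x _ /=.
  by rewrite -big_mkcond big_pred1_eq.
pose masked w := ((phi w).1, keep_on y0 C (phi w).2).
have F_gt0 w : 0 < P w -> forall i, 0 < F i (coord i (masked w)).
  move=> Pw i; rewrite /F /coord ffunE /=; case: (i \in C); first exact: P_mu.
  by rewrite eqxx; exact: (law_gt0 P_distr (fun w => (phi w).1 i)).
apply: Rle_trans (gibbs_prod_law (phi := masked) P_distr m F_distr F_gt0).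
rewrite [X in _ <= X - _](bigID (fun j => j \in C)) /=; apply: Req_le; congr (_ + _ - _).
  by apply: eq_bigr => i iC; apply: eq_bigr => w _; rewrite /F iC /coord ffunE iC.
apply: eq_bigr => i /negbTE iC; apply: eq_bigr => w _.
by rewrite /F iC /coord ffunE iC eqxx.
Qed.

Lemma sum_view_div_le :
  \sum_(j | j \notin C) view_div P mu (fun w => coord j (phi w)) (obs j) fst <=
  kl (law P phi) (prod_law (fun _ => mu)) + ln (INR #|M|).
Proof.
have full : negent P (partial setT) <= negent P phi.
  apply: le_negent => // v w [eq_x /keep_onP eq_y _].
  by apply: injective_projections => //; apply/ffunP => i; exact: eq_y.
apply: Rle_trans (_ : _ <= \sum_(j | j \notin C)
  ((negent P (partial (j |: B j)) - negent P (partial (B j))) +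
   (negent P (fun w => (phi w).1 j) - mean_ln j))) _.
  have rearrange a b c d e : a - b <= c -> a - d - b + e <= c + (e - d) by lra.
  apply: Rsum_le => j _; rewrite view_divE => [|//|w Pw]; last exact: P_mu.
  exact/rearrange/chain_step.
rewrite big_split (B_telescope (fun S => negent P (partial S))) RsumB /=.
rewrite kl_law_negent //; last by move=> w /P_mu; exact: prod_law_gt0.
rewrite expect_ln_prod_law // [X in _ <= _ - X + _](bigID (fun j => j \in C)) /=.
have rearrange a b c d e f l : b <= a -> c + d - l <= e ->
  b - e + (d - f) <= a - (c + f) + l by lra.
exact: rearrange full negent_partial_ge.
Qed.

End ChainRule.

(** * Conditioning a protocol on success *)

Definition cond_on (W : finType) (P : W -> R) (A : pred W) (w : W) : R :=
  if A w then P w / prob P A else 0.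

Section ConditionalDistribution.
Variables (W : finType) (P : W -> R) (A : pred W).
Hypothesis P_distr : is_distr P.
Hypothesis A_gt0 : 0 < prob P A.

Lemma prob_cond_on (E : pred W) :
  prob (cond_on P A) E = prob P (fun w => A w && E w) / prob P A.
Proof. by rewrite /prob /Rdiv Rmult_suml big_mkcondl big_mkcond. Qed.

Lemma cond_on_distr : is_distr (cond_on P A).
Proof.
split=> [w|].
  by rewrite /cond_on; case: ifP => _; [apply: Rdiv_ge0; [exact: P_distr.1 | lra] | lra].
rewrite -[LHS]/(prob (cond_on P A) xpredT) prob_cond_on -[RHS](Rinv_r (prob P A)); last lra.
by congr (_ * _); apply: eq_prob => w; rewrite andbT.
Qed.

Lemma cond_on_gt0 w : 0 < cond_on P A w -> A w /\ 0 < P w.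
Proof.
rewrite /cond_on; case: ifP => [_ PA|]; last lra.
by split=> //; case: (P_distr.1 w) PA => // <-; rewrite /Rdiv Rmult_0_l; lra.
Qed.

Lemma kl_cond_on : kl (cond_on P A) P = - ln (prob P A).
Proof.
rewrite -[RHS](expect_const _ cond_on_distr); apply: (eq_expect cond_on_distr.1) => w.
move=> /cond_on_gt0 [Aw Pw]; rewrite /cond_on Aw -ln_Rinv //; congr ln.
by field; lra.
Qed.

End ConditionalDistribution.

Lemma kl_law_id (W : finType) (P Q : W -> R) : kl (law P id) Q = kl P Q.
Proof. by rewrite /kl expect_law; apply: eq_bigr => w _; rewrite /law /prob big_pred1_eq. Qed.

Definition rectangular (A B M : Type) (lf : A -> B -> M) : Prop :=
  forall a b a' b', lf a b = lf a' b' -> lf a b' = lf a b.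

Lemma rectangularE (A B M : finType) (lf : A -> B -> M) a b m : rectangular lf ->
  (lf a b == m) = [exists b', lf a b' == m] && [exists a', lf a' b == m].
Proof.
move=> rect; apply/eqP/andP => [<-|[/existsP[b' /eqP lf_ab'] /existsP[a' /eqP lf_a'b]]].
  by split; apply/existsP; [exists b | exists a].
by rewrite -lf_ab'; apply: (rect _ _ a'); rewrite lf_ab'.
Qed.

Definition has_leaves (A B O : Type) (g : A -> B -> O) (d : nat) : Prop :=
  exists (M : finType) (lf : A -> B -> M) (out : M -> O),
  [/\ (#|M| <= 2 ^ d)%N, rectangular lf & forall a b, g a b = out (lf a b)].

Lemma has_leaves_branch (A B O : Type) (turn : A -> B -> bool) (g h : A -> B -> O) (d e : nat) :
  rectangular turn -> has_leaves g d -> has_leaves h e ->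
  has_leaves (fun a b => if turn a b then g a b else h a b) (maxn d e).+1.
Proof.
move=> turn_rect [M [lf [out [cardM lf_rect gE]]]] [N [lf' [out' [cardN lf'_rect hE]]]].
exists (M + N)%type, (fun a b => if turn a b then inl (lf a b) else inr (lf' a b)),
  (fun m => match m with inl m => out m | inr m => out' m end); split.
- rewrite card_sum expnS mul2n -addnn; apply: leq_add.
    by apply: leq_trans cardM _; rewrite leq_exp2l // leq_maxl.
  by apply: leq_trans cardN _; rewrite leq_exp2l // leq_maxr.
- move=> a b a' b' same; have turnE : turn a b' = turn a b.
    by apply: (turn_rect _ _ a'); case: (turn a b) (turn a' b') same => [] [].
  move: same; rewrite turnE; case: (turn a b); case: (turn a' b') => // -[].
    by move/lf_rect ->.
  by move/lf'_rect ->.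
- by move=> a b; case: ifP.
Qed.

Lemma run_has_leaves (A B O : Type) (P : proto A B O) : has_leaves (run P) (depth P).
Proof.
elim: P => [o|g l IHl r IHr|g l IHl r IHr] /=.
- by exists unit, (fun _ _ => tt), (fun _ => o); rewrite card_unit.
- by apply: has_leaves_branch.
- by apply: has_leaves_branch => // a b a' b' /= ->.
Qed.

Section CoordinateOrder.
Variables (t : nat) (C : {set 'I_t}).

Definition before (r : 'I_t -> 'I_t) (j : 'I_t) : {set 'I_t} :=
  [set i | (r i < r j)%N || (i \in C)].

Lemma in_before r j i : (i \in before r j) = (r i < r j)%N || (i \in C).
Proof. by rewrite inE. Qed.

Lemma sub_before r j : C \subset before r j.
Proof. by apply/subsetP => i iC; rewrite in_before iC orbT. Qed.

Lemma telescope_before (r : 'I_t -> 'I_t) (G : {set 'I_t} -> R) : injective r ->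
  \sum_(j | j \notin C) (G (j |: before r j) - G (before r j)) = G setT - G C.
Proof.
move=> r_inj; pose G_upto n := G [set i | (r i < n)%N || (i \in C)].
have G_all : G setT = G_upto t by congr G; apply/setP => i; rewrite !inE ltn_ord.
have G_none : G C = G_upto 0%N by congr G; apply/setP => i; rewrite !inE.
have G_next j : G (j |: before r j) = G_upto (r j).+1.
  congr G; apply/setP => i.
  by rewrite !inE ltnS [in RHS]leq_eqVlt val_eqE (inj_eq r_inj) orbA.
rewrite G_all G_none -(Rsum_telescope t G_upto) [RHS](reindex r) /=; last first.
  exact: (onW_bij _ (injF_bij r_inj)).
rewrite big_mkcond; apply: eq_bigr => j _; rewrite G_next; case: ifP => [_ //|/negbFE jC].
have -> : G_upto (r j).+1 = G_upto (r j); last by lra.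
by rewrite -G_next; congr G; apply/setUidPr; rewrite sub1set (subsetP (sub_before r j)).
Qed.

End CoordinateOrder.

Definition only_answer (X Y Z : finType) (f : relation3 X Y Z) (z : Z) (u : X * Y) : bool :=
  rel_at f u.1 u.2 == [set z].

Definition differ (X Y Z : finType) (f g : relation3 X Y Z) (u : X * Y) : bool :=
  rel_at f u.1 u.2 != rel_at g u.1 u.2.

Definition rejects (X Y Z : finType) (g : relation3 X Y Z) (z : Z) (u : X * Y) : bool :=
  z \notin rel_at g u.1 u.2.

Lemma exp_tail_div_le (eps s : R) : 0 < eps -> 0 <= s -> 1 <= 44 * eps * s ->
  exp (- (4 * s)) * (exp s * exp s) / (18 * eps) <= 19.8 * eps.
Proof.
move=> eps_gt0 s_ge0 eps_s; apply/Rle_div_l; first lra.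
have -> : exp (- (4 * s)) * (exp s * exp s) = / exp (2 * s).
  by rewrite -exp_Ropp -!exp_plus; congr exp; lra.
have exp_ge := exp_ge_square (_ : 0 <= 2 * s); have e_ge := exp1_ge.
have exp_gt0 := exp_pos (2 * s); apply: (Rmult_le_reg_r (exp (2 * s))) => //.
rewrite Rinv_l; last lra.
have : 1 <= 19.8 * 18 * (eps * (exp 1 * s)) ^ 2.
  have : 2.44 / 44 <= eps * (exp 1 * s) by nra.
  by rewrite /=; nra.
have -> : (eps * (exp 1 * s)) ^ 2 = eps ^ 2 * (exp 1 * (2 * s / 2)) ^ 2 by field.
have := Rmult_le_compat_l (eps ^ 2) _ _ (pow2_ge_0 eps) (exp_ge ltac:(lra)).
by rewrite /=; lra.
Qed.

(* The losses are [4 + 1.2 + 8 + 19.8 = 33] times [eps]. *)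
Lemma truncation_loss_le (eps s beta p div : R) :
  0 < eps -> 5 / 4 <= s -> 1 <= 44 * eps * s -> beta - 4 * eps <= p -> p <= 1 ->
  0 <= div -> div <= 1.2 * eps * (s - 1) ->
  beta - 33 * eps <= (1 - 18 * eps / exp s) * (p - div / (s - 1)) -
    exp (- (4 * s)) * (exp s * exp s) / (18 * eps).
Proof.
move=> eps_gt0 s_ge eps_s p_ge p_le div_ge0 div_le.
have tail_le := exp_tail_div_le eps_gt0 (_ : 0 <= s) eps_s.
have ratio_le : div / (s - 1) <= 1.2 * eps by apply/Rle_div_l; lra.
have ratio_ge0 : 0 <= div / (s - 1) by apply: Rdiv_ge0; lra.
have exp_ge := exp_ineq1_le s.
have trunc_le : 18 * eps / exp s <= 8 * eps by apply/Rle_div_l; nra.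
have trunc_ge0 : 0 <= 18 * eps / exp s by apply: Rdiv_ge0; lra.
by have := tail_le ltac:(lra); nra.
Qed.

Lemma exists_le_le_of_sum_lt (I : finType) (D : pred I) (a b : I -> R) (alpha beta : R) :
  (forall i, 0 <= a i) -> (forall i, 0 <= b i) -> 0 < alpha -> 0 < beta ->
  (\sum_(i | D i) a i) / alpha + (\sum_(i | D i) b i) / beta < INR #|D| ->
  exists2 i, D i & a i <= alpha /\ b i <= beta.
Proof.
move=> a_ge0 b_ge0 alpha_gt0 beta_gt0 sum_lt.
case: (pickP (fun i => [&& D i, Rleb (a i) alpha & Rleb (b i) beta])) => [i|none].
  by move=> /and3P[Di /RlebP ai /RlebP bi]; exists i.
case: (Rlt_not_le _ _ sum_lt); rewrite -[INR _]Rmult_1_r -Rsum_const /Rdiv !Rmult_suml -big_split.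
apply: Rsum_le => i Di /=; have := none i; rewrite Di /=.
have a_div := Rdiv_ge0 (a_ge0 i) (Rlt_le _ _ alpha_gt0).
have b_div := Rdiv_ge0 (b_ge0 i) (Rlt_le _ _ beta_gt0).
have gt1_div x y : 0 < y -> ~ x <= y -> 1 < x / y by move=> ? ?; apply/Rlt_div_r; lra.
case: RlebP => [_|/(gt1_div _ _ alpha_gt0)]; last by rewrite /Rdiv in b_div *; lra.
by case: RlebP => // /(gt1_div _ _ beta_gt0); rewrite /Rdiv in a_div *; lra.
Qed.

Section ConditionedProtocol.
Variables (X Y Z M : finType) (f : relation3 X Y Z) (t : nat) (mu : X * Y -> R).
Local Notation XT := {ffun 'I_t -> X}.
Local Notation YT := {ffun 'I_t -> Y}.
Variables (lf : XT -> YT -> M) (out : M -> {ffun 'I_t -> Z}) (x0 : X) (y0 : Y).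
Hypothesis mu_distr : is_distr mu.
Hypothesis lf_rect : rectangular lf.

Local Notation inputs := (XT * YT)%type.
Local Notation power := (prod_law (fun _ : 'I_t => mu)).

Definition solves (i : 'I_t) (w : inputs) : bool := (w.1 i, w.2 i, out (lf w.1 w.2) i) \in f.

Definition solves_all (C : {set 'I_t}) (w : inputs) : bool := [forall (i | i \in C), solves i w].

Definition success (C : {set 'I_t}) : R := prob power (solves_all C).

Definition posterior (C : {set 'I_t}) : inputs -> R := cond_on power (solves_all C).

Lemma solves_all_setU1 j C w : solves_all (j |: C) w = solves_all C w && solves j w.
Proof.
apply/forall_inP/andP => [all_jC|[/forall_inP all_C solves_j] i].
  split; last by apply: all_jC; rewrite setU11.
  by apply/forall_inP => i iC; apply: all_jC; rewrite setU1r.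
by rewrite in_setU1 => /orP[/eqP->|/all_C].
Qed.

Lemma power_distr : is_distr power.
Proof. exact: prod_law_distr. Qed.

Lemma power_gt0 w i : 0 < power w -> 0 < mu (coord i w).
Proof.
rewrite /prod_law (bigD1 i) //=; case: (mu_distr.1 (coord i w)) => // <-.
by rewrite Rmult_0_l; lra.
Qed.

Section Posterior.
Variable C : {set 'I_t}.
Hypothesis success_gt0 : 0 < success C.

Local Notation post := (posterior C).
Local Notation upto := (before C id).
Local Notation from := (before C (@rev_ord t)).

Lemma posterior_distr : is_distr post.
Proof. exact: cond_on_distr power_distr success_gt0. Qed.

Lemma posterior_mu_gt0 w : 0 < post w -> forall i, 0 < mu (coord i w).
Proof. by move=> /(cond_on_gt0 power_distr)[_ pw] i; exact: power_gt0. Qed.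

Lemma prob_posterior_solves j : prob post (solves j) = success (j |: C) / success C.
Proof.
by rewrite prob_cond_on; congr (_ / _); apply: eq_prob => w; rewrite solves_all_setU1.
Qed.

Definition transcript (j : 'I_t) (w : inputs) : XT * YT * M :=
  (keep_on x0 (upto j) w.1, keep_on y0 (from j) w.2, lf w.1 w.2).

Definition coord_div (j : 'I_t) : R := kl (law post (coord j)) mu.

Definition transcript_div (j : 'I_t) : R :=
  view_div post mu (coord j) (transcript j) fst + view_div post mu (coord j) (transcript j) snd.

Lemma coord_div_ge0 j : 0 <= coord_div j.
Proof.
apply: kl_ge0; [exact: (law_distr posterior_distr) | exact: is_distr_subdistr |].
by apply: (law_dominated posterior_distr) => w /posterior_mu_gt0.
Qed.

Lemma transcript_div_ge0 j : 0 <= transcript_div j.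
Proof.
have post_mu w : 0 < post w -> 0 < mu (coord j w) by move=> /posterior_mu_gt0.
by apply: Rplus_le_le_0_compat; apply: (view_div_ge0 _ _ posterior_distr) => //;
  exact: is_distr_subdistr.
Qed.

Lemma sum_coord_div_le : \sum_j coord_div j <= - ln (success C).
Proof.
rewrite -(kl_cond_on power_distr success_gt0) -kl_law_id.
exact: (kl_prod_law_superadditive (phi := id) posterior_distr posterior_mu_gt0).
Qed.

Lemma sum_view_div_fst_le :
  \sum_(j | j \notin C) view_div post mu (coord j) (transcript j) fst <=
  - ln (success C) + ln (INR #|M|).
Proof.
rewrite -(kl_cond_on power_distr success_gt0) -kl_law_id.
apply: (sum_view_div_le (phi := id) (m := fun w => lf w.1 w.2) (y0 := y0) (B := from)) => //.
- exact: posterior_distr.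
- exact: posterior_mu_gt0.
- by move=> j v w [eq_x eq_y eq_leaf]; rewrite /transcript eq_leaf eq_y eq_x.
- by move=> j v w [_ eq_y eq_leaf]; rewrite eq_y eq_leaf.
- by move=> G; apply: telescope_before; exact: rev_ord_inj.
Qed.

Lemma sum_view_div_snd_le :
  \sum_(j | j \notin C) view_div post mu (coord j) (transcript j) snd <=
  - ln (success C) + ln (INR #|M|).
Proof.
pose mu' (u : Y * X) := mu (u.2, u.1); pose swap (w : inputs) := (w.2, w.1).
have mu'_distr : is_distr mu'.
  split=> [u|]; first exact: mu_distr.1.
  by rewrite Rsum_pair exchange_big -mu_distr.2 Rsum_pair.
have -> : - ln (success C) = kl (law post swap) (prod_law (fun _ => mu')).
  rewrite -(kl_cond_on power_distr success_gt0) -kl_law_id.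
  apply: (eq_kl_law posterior_distr) => [v w /= -> //|v w [eq_y eq_x]|w //].
  exact: injective_projections.
rewrite (eq_bigr _ (fun j _ => view_div_swap _ _ _ posterior_distr)).
apply: (sum_view_div_le (phi := swap) (m := fun w => lf w.1 w.2) (y0 := x0) (B := upto)) => //.
- exact: posterior_distr.
- by move=> w /posterior_mu_gt0.
- by move=> j v w [eq_y eq_x eq_leaf]; rewrite /transcript eq_leaf eq_y eq_x.
- by move=> j v w [eq_x _ eq_leaf]; rewrite eq_x eq_leaf.
- by move=> G; exact: telescope_before.
Qed.

Lemma sum_transcript_div_le :
  \sum_(j | j \notin C) transcript_div j <= 2 * (- ln (success C) + ln (INR #|M|)).
Proof.
rewrite big_split -Rplus_diag.
exact: Rplus_le_compat sum_view_div_fst_le sum_view_div_snd_le.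
Qed.

Definition alice_consistent (j : 'I_t) (o : XT * YT * M) (a : XT) : bool :=
  (keep_on x0 (upto j) a == o.1.1) && [exists b, lf a b == o.2].

Definition bob_consistent (j : 'I_t) (o : XT * YT * M) (b : YT) : bool :=
  [&& keep_on y0 (from j) b == o.1.2, [exists a, lf a b == o.2] &
      [forall (i | i \in C), (o.1.1 i, b i, out o.2 i) \in f]].

Definition alice_factor (j : 'I_t) (o : XT * YT * M) (x : X) : R :=
  \sum_(a : XT | (a j == x) && alice_consistent j o a)
    \prod_(i | (i \notin C) && (j < i)%N) mu (a i, o.1.2 i).

Definition bob_factor (j : 'I_t) (o : XT * YT * M) (y : Y) : R :=
  (\sum_(b : YT | (b j == y) && bob_consistent j o b)
    \prod_(i | i \in upto j) mu (o.1.1 i, b i)) / success C.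

Lemma alice_factor_ge0 j o x : 0 <= alice_factor j o x.
Proof. by apply: Rsum_ge0 => a _; apply: Rprod_ge0 => i _; exact: mu_distr.1. Qed.

Lemma bob_factor_ge0 j o y : 0 <= bob_factor j o y.
Proof.
apply: Rdiv_ge0; last lra.
by apply: Rsum_ge0 => b _; apply: Rprod_ge0 => i _; exact: mu_distr.1.
Qed.

Lemma consistentE j o a b : (transcript j (a, b) == o) && solves_all C (a, b) =
  alice_consistent j o a && bob_consistent j o b.
Proof.
case: o => [[o1 o2] m]; rewrite /alice_consistent /bob_consistent /transcript !xpair_eqE /=.
rewrite (rectangularE _ _ _ lf_rect).
case: (keep_on x0 _ a =P o1) => //= o1E.
case: (keep_on y0 _ b =P o2) => _ //=; last by rewrite andbF.
case: existsP => [[b' /eqP lf_ab']|] //=; case: existsP => [[a' /eqP lf_a'b]|] //=.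
apply: eq_forallb => i; case: (boolP (i \in C)) => //= iC; rewrite /solves /=.
have -> : lf a b = m by rewrite (@lf_rect a b' a' b) lf_ab'.
by rewrite -o1E ffunE (subsetP (sub_before _ _ _)).
Qed.

(* Every input of Alice that the transcript hides faces an input of Bob that it reveals,
   and vice versa. *)
Lemma power_split j o a b : j \notin C -> alice_consistent j o a -> bob_consistent j o b ->
  power (a, b) = mu (a j, b j) *
    (\prod_(i | (i \notin C) && (j < i)%N) mu (a i, o.1.2 i) *
     \prod_(i | i \in upto j) mu (o.1.1 i, b i)).
Proof.
move=> jC /andP[/eqP <- _] /and3P[/eqP <- _ _].
rewrite /prod_law (bigD1 j) //=; congr (_ * _).
rewrite (bigID (fun i => i \in upto j)) Rmult_comm /=; congr (_ * _); apply: eq_big => i.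
- by rewrite in_before; case: (i =P j) => [->|]; rewrite //= ltnn (negbTE jC).
- by move=> /andP[_ iu]; rewrite ffunE iu.
- rewrite in_before negb_or -leqNgt [(j < i)%N]ltn_neqAle [in RHS]eq_sym -val_eqE /=.
  by rewrite andbA andbC.
- rewrite in_before negb_or -leqNgt => /and3P[ij ji _].
  by rewrite ffunE in_before /= ltn_sub2lE // ltnS ltn_neqAle ji val_eqE eq_sym ij.
Qed.

Lemma posterior_factor j u o : j \notin C ->
  law post (fun w => (coord j w, transcript j w)) (u, o) =
  mu u * density (alice_factor j) (bob_factor j) u o.
Proof.
move=> jC; rewrite /density /bob_factor !Rmult_div_assoc big_distrlr pair_big Rmult_sumr.
rewrite /law prob_cond_on; congr (_ / _); apply: eq_big => [[a b]|[a b]] /=.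
  rewrite xpair_eqE andbC -andbA consistentE; case: u => x y.
  by rewrite /coord xpair_eqE andbACA.
move=> /andP[ab_solves]; rewrite xpair_eqE => /andP[/eqP <- oE].
have := consistentE j o a b; rewrite oE ab_solves => /esym/andP[].
exact: power_split.
Qed.

Section FailingCoordinate.
Variables (g : relation3 X Y Z) (z : Z) (eps delta eta s : R).
Local Notation beta := (prob mu (only_answer f z)).
Hypothesis eps_bounds : 0 < eps < 1 / 55.
Hypothesis eta_ge0 : 0 <= eta.
Hypothesis close : prob mu (differ f g) <= delta.
Hypothesis dense : rect_dense mu (rejects g z) eta (exp (- (4 * s))).
Hypothesis gap : delta + 22 * eps < eta * (beta - 33 * eps).

Section Coordinate.
Variable j : 'I_t.
Hypothesis coord_div_le : coord_div j <= eps * eps.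

Definition answers (w : inputs) : bool := out (lf w.1 w.2) j == z.

Lemma prob_posterior_coord_le (E : pred (X * Y)) :
  prob post (fun w => E (coord j w)) <= prob mu E + 3 * eps.
Proof.
rewrite -prob_law; apply: prob_le_of_kl_le => //; last lra.
- exact: (law_distr posterior_distr).
- exact: is_distr_subdistr.
- by apply: (law_dominated posterior_distr) => w /posterior_mu_gt0.
Qed.

Hypothesis fail_le : prob post (predC (solves j)) <= eps.

Lemma prob_wrong_answer_le :
  prob post (fun w => rejects g z (coord j w) && answers w) <= delta + 4 * eps.
Proof.
have differ_le := prob_posterior_coord_le (differ f g).
have : prob post (fun w => rejects g z (coord j w) && answers w) <=
    prob post (fun w => differ f g (coord j w)) + prob post (predC (solves j)).
  apply: (prob_union_le posterior_distr.1) => w _ /andP[zg /eqP out_z].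
  rewrite /differ /coord /=; case: eqP => //= fg.
  by rewrite /solves out_z; move: zg; rewrite /rejects /= -fg inE.
lra.
Qed.

Lemma prob_answers_ge : beta - 4 * eps <= prob post answers.
Proof.
have other_le := prob_posterior_coord_le (predC (only_answer f z)).
rewrite (prob_compl _ mu_distr) in other_le.
have : prob post (predC answers) <=
    prob post (fun w => predC (only_answer f z) (coord j w)) + prob post (predC (solves j)).
  apply: (prob_union_le posterior_distr.1) => w _; apply: contraNT; rewrite negb_or !negbK.
  by move=> /andP[/eqP fz]; rewrite /answers -in_set1 -fz inE.
by rewrite (prob_compl _ posterior_distr); lra.
Qed.

End Coordinate.

Hypothesis s_ge : 5 / 4 <= s.
Hypothesis eps_s : 1 <= 44 * eps * s.

Lemma failing_coordinate j : j \notin C ->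
  coord_div j <= eps * eps -> transcript_div j <= 1.2 * eps * (s - 1) ->
  success (j |: C) < (1 - eps) * success C.
Proof.
move=> jC coord_le transcript_le; apply: Rnot_le_lt => success_ge.
have fail_le : prob post (predC (solves j)) <= eps.
  rewrite (prob_compl _ posterior_distr); suff : 1 - eps <= prob post (solves j) by lra.
  rewrite prob_posterior_solves; exact/Rle_div_r.
have wrong_le := prob_wrong_answer_le coord_le fail_le.
have right_ge := prob_answers_ge coord_le fail_le.
have right_le : prob post (answers j) <= 1 by exact: prob_distr_le1 posterior_distr.
have exp_ge := exp_ineq1_le s.
have eps_gt0 : 0 < eps by lra.
have loss_le := truncation_loss_le eps_gt0 s_ge eps_s right_ge right_le
  (transcript_div_ge0 j) transcript_le.
have copy_le : eta * ((1 - 18 * eps / exp s) *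
      (prob post (answers j) - transcript_div j / (s - 1)) -
      exp (- (4 * s)) * (exp s * exp s) / (18 * eps)) <=
    prob post (fun w => rejects g z (coord j w) && answers j w) + 18 * eps.
  apply: (single_copy posterior_distr mu_distr (alice_factor_ge0 j) (bob_factor_ge0 j)
    (fun u o => posterior_factor u o jC) (fun o => out o.2 j == z)) => //; try lra.
  exact/Rlt_le/exp_pos.
by have := Rmult_le_compat_l eta _ _ eta_ge0 loss_le; lra.
Qed.

Lemma exists_failing_coordinate (S : R) : (0 < t)%N -> 10 < S -> S <= 8 * s ->
  ln (INR #|M|) <= eps ^ 2 / 32 * INR t * (11 * eps * S) ->
  - ln (success C) <= eps ^ 3 * INR t / 16 -> INR #|C| <= eps ^ 2 * INR t / 32 ->
  exists2 j, j \notin C & success (j |: C) < (1 - eps) * success C.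
Proof.
move=> t_gt0 S_gt S_le M_le success_ge C_le.
have INR_t_gt0 : 0 < INR t by apply: lt_0_INR; apply/ltP.
have coord_sum : \sum_(j | j \notin C) coord_div j <= eps ^ 3 * INR t / 16.
  apply: Rle_trans success_ge; apply: Rle_trans sum_coord_div_le.
  by apply: Rsum_le_subpred => // j; exact: coord_div_ge0.
have transcript_sum : \sum_(j | j \notin C) transcript_div j <=
    2 * (eps ^ 3 * INR t / 16 + eps ^ 2 / 32 * INR t * (11 * eps * S)).
  apply: Rle_trans sum_transcript_div_le _; apply: Rmult_le_compat_l; first lra.
  exact: Rplus_le_compat.
have card_notC : INR #|[predC C]| = INR t - INR #|C|.
  by have := congr1 INR (cardC C); rewrite card_ord plus_INR; lra.
have coord_ratio : (\sum_(j | j \notin C) coord_div j) / (eps * eps) <= eps * INR t / 16.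
  by apply/Rle_div_l; [nra | move: coord_sum; rewrite /=; lra].
have transcript_ratio : (\sum_(j | j \notin C) transcript_div j) / (0.03 * eps * S) <=
    25 * (eps * eps) * INR t.
  apply/Rle_div_l; first nra.
  apply: Rle_trans transcript_sum _.
  have cube_ge0 : 0 <= eps * eps * eps * INR t by apply: Rmult_le_pos; nra.
  have := Rmult_le_compat_l _ _ _ cube_ge0 (Rlt_le _ _ S_gt); rewrite /=; lra.
have [|||j jC [coord_le transcript_le]] := @exists_le_le_of_sum_lt _ [predC C] coord_div
  transcript_div (eps * eps) (0.03 * eps * S) coord_div_ge0 transcript_div_ge0.
- nra.
- nra.
- rewrite card_notC; apply: Rle_lt_trans (Rplus_le_compat _ _ _ _ coord_ratio transcript_ratio) _.
  have eps_t : eps * INR t <= INR t / 55 by nra.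
  have : eps * (eps * INR t) <= eps * (INR t / 55) by apply: Rmult_le_compat_l; lra.
  by move: C_le; rewrite /=; lra.
- exists j => //; apply: failing_coordinate => //.
  by apply: Rle_trans transcript_le _; nra.
Qed.

End FailingCoordinate.
End Posterior.
End ConditionedProtocol.

(** * The direct product theorem *)

Lemma nat_floor_le (x : R) : 0 <= x -> INR (nat_floor x) <= x.
Proof.
move=> x_ge0; have [floor_le floor_gt] := base_Int_part x.
rewrite /nat_floor INR_IZR_INZ Z2Nat.id //.
have : (-1 < Int_part x)%Z by apply: lt_IZR; lra.
lia.
Qed.

Lemma Rmin_seq_le (s : seq R) (v : R) : v \in s -> Rmin_seq s <= v.
Proof.
case: s => // a s; elim: s => [|b s IH] /=; first by rewrite inE => /eqP ->; exact: Rle_refl.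
have min_b := Rmin_l b (foldr Rmin a s); have min_s := Rmin_r b (foldr Rmin a s).
rewrite !inE /= in IH * => /or3P[va|/eqP -> //|vs]; apply: Rle_trans min_s (IH _).
  by rewrite va.
by rewrite vs orbT.
Qed.

Lemma Rmax_seq_mem (s : seq R) : Rmax_seq s <> 0 -> Rmax_seq s \in s.
Proof.
case: s => [//|a s] _ /=; elim: s => [|b s IH] /=; first by rewrite inE.
rewrite /Rmax; case: Rle_dec => _; last by rewrite !inE eqxx orbT.
by move: IH; rewrite !inE => /orP[->|->]; rewrite ?orbT.
Qed.

Lemma srec_witness (X Y Z : finType) (mu : X * Y -> R) (f : relation3 X Y Z) (z : Z)
    (eta delta : R) (S := srec mu f z eta delta) :
  (forall u, 0 <= mu u) -> 0 < S ->
  exists2 g : relation3 X Y Z, prob mu (differ f g) <= delta &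
    rect_dense mu (rejects g z) eta (exp (- (S * ln 2))).
Proof.
move=> mu_ge0 S_gt0; have : S \in [seq rec mu g z eta | g <- enum {: relation3 X Y Z}
    & Rleb (prob mu (fun p => rel_at f p.1 p.2 != rel_at g p.1 p.2)) delta].
  by apply: Rmax_seq_mem; exact: Rgt_not_eq.
move=> /mapP[g]; rewrite mem_filter => /andP[/RlebP close _] S_rec; exists g => // AB large.
have ln2_gt0 : 0 < ln 2 by have := ln_lt_2; lra.
have AB_gt0 : 0 < prob mu (in_rect AB) by apply: Rlt_trans large; exact: exp_pos.
have : ~~ rect_ok mu g z eta AB.
  apply/negP => AB_ok; have : S <= log2 (/ prob mu (in_rect AB)).
    by rewrite S_rec; apply: Rmin_seq_le; apply: map_f; rewrite mem_filter AB_ok mem_enum.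
  rewrite /log2 ln_Rinv // => /Rle_div_r => /(_ ln2_gt0).
  by have := ln_increasing _ _ (exp_pos _) large; rewrite ln_exp; lra.
rewrite /rect_ok; case: RltbP => //= _ /RlebP /Rnot_le_lt.
have complement a b r : r = a + b -> a < (1 - eta) * r -> eta * r < b by lra.
by apply: complement; rewrite /prob (bigID (fun u => z \in rel_at g u.1 u.2)).
Qed.

Lemma exists_le_weighted_avg (I : Type) (s : seq I) (w F : I -> R) (k : R) :
  (forall i, List.In i s -> 0 <= w i) -> \sum_(i <- s) w i = 1 ->
  \sum_(i <- s) w i * F i <= k -> exists2 i, List.In i s & F i <= k.
Proof.
move=> w_ge0 w_sum avg_le.
have [m ms F_min] : exists2 m, List.In m s & forall i, List.In i s -> F m <= F i.
  have : s <> [::] by move=> s_nil; move: w_sum; rewrite s_nil big_nil; lra.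
  elim: (s) => // a [|b s'] IH _; first by exists a; [left | move=> i [<-|//]; lra].
  have [m ms F_min] := IH ltac:(done); case: (Rle_dec (F a) (F m)) => Fam.
    by exists a; [left | move=> i [<-|/F_min]; lra].
  by exists m; [right | move=> i [<-|/F_min]; lra].
exists m => //; apply: Rle_trans avg_le; rewrite -[F m]Rmult_1_l -w_sum Rmult_suml.
elim: (s) w_ge0 F_min => [|a s' IH] w_ge0 F_min; first by rewrite !big_nil; lra.
rewrite !big_cons; apply: Rplus_le_compat.
  by apply: Rmult_le_compat_l; [apply: w_ge0; left | apply: F_min; left].
by apply: IH => i i_s'; [apply: w_ge0; right | apply: F_min; right].
Qed.

Lemma depth_le_pub_cost (A B O : Type) (P : pubproto A B O) wp :
  List.In wp P -> (depth wp.2 <= pub_cost P)%N.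
Proof.
rewrite /pub_cost; elim: P => //= a s IH [->|/IH le_s]; rewrite big_cons; first exact: leq_maxl.
exact: leq_trans le_s (leq_maxr _ _).
Qed.

Lemma yao_deterministic_proto (A B : finType) (O : Type) (g : A -> B -> O -> bool)
    (P : pubproto A B O) (nu : A * B -> R) (err : R) :
  pub_wf P -> (forall a b, pub_err g P a b <= err) -> is_distr nu ->
  exists2 p : proto A B O, (depth p <= pub_cost P)%N &
    prob nu (fun w => ~~ g w.1 w.2 (run p w.1 w.2)) <= err.
Proof.
move=> [P_ge0 P_sum] P_err nu_distr.
have [|wp wpP wp_err] := exists_le_weighted_avg (w := fst) (s := P) (k := err)
  (F := fun wp => prob nu (fun w => ~~ g w.1 w.2 (run wp.2 w.1 w.2))) P_ge0 P_sum _.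
  apply: Rle_trans (_ : expect nu (fun w => pub_err g P w.1 w.2) <= _); last first.
    by rewrite -(expect_const err nu_distr); apply: (le_expect nu_distr.1) => w _; exact: P_err.
  right; rewrite /expect /pub_err; under [RHS]eq_bigr => w _ do rewrite Rmult_sumr big_mkcond.
  rewrite exchange_big; apply: eq_bigr => wp _; rewrite Rmult_sumr [LHS]big_mkcond.
  by apply: eq_bigr => w _; rewrite (Rmult_comm wp.1).
by exists wp.2; [exact: depth_le_pub_cost|].
Qed.

Lemma greedy_decay (T : finType) (F : {set T} -> R) (r : R) (k : nat) :
  0 <= r -> F set0 <= 1 ->
  (forall C : {set T}, (#|C| <= k)%N -> exists2 j, j \notin C & F (j |: C) < r * F C) ->
  exists C, F C <= r ^ k.+1.
Proof.
move=> r_ge0 F0 step.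
suff decay n : (n <= k.+1)%N -> exists2 C : {set T}, #|C| = n & F C <= r ^ n.
  by have [C _ FC] := decay k.+1 (leqnn _); exists C.
elim: n => [_|n IH nk]; first by exists set0; rewrite ?cards0.
have [C cardC FC] := IH (ltnW nk); have [|j jC FjC] := step C; first by rewrite cardC.
exists (j |: C); first by rewrite cardsU1 jC cardC.
by apply: Rle_trans (Rlt_le _ _ FjC) _; apply: Rmult_le_compat_l.
Qed.

Lemma ln_leaves_le (M : finType) (d : nat) :
  (#|M| <= 2 ^ d)%N -> 0 < INR #|M| -> ln (INR #|M|) <= INR d.
Proof.
move=> cardM M_gt0; have INR_pow2 : INR (2 ^ d)%N = 2 ^ d.
  by elim: d {cardM} => [//|d IH]; rewrite expnS mult_INR IH.
have : ln (INR #|M|) <= ln (2 ^ d) by apply: ln_le => //; rewrite -INR_pow2; exact/le_INR/leP.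
have ln2_le : ln 2 <= 1 by have := @ln_ge_1sub (/ 2) ltac:(lra); rewrite ln_Rinv ?Rinv_inv; lra.
by have := pos_INR d; rewrite ln_pow; nra.
Qed.

Lemma neg_ln_le_of_pow_le (eps p : R) (k : nat) :
  0 <= eps <= 1 / 2 -> (1 - eps) ^ k <= p -> - ln p <= INR k * (2 * eps).
Proof.
move=> eps_bounds p_ge; have base_gt0 : 0 < 1 - eps by lra.
have := ln_le _ _ (pow_lt _ k base_gt0) p_ge; rewrite ln_pow // => ln_p_ge.
have : 1 - 2 * eps - 1 <= ln (1 - eps).
  apply: Rle_trans (ln_ge_1sub base_gt0).
  have : / (1 - eps) <= 1 + 2 * eps; last by lra.
  by apply: (Rmult_le_reg_l (1 - eps)); [lra | rewrite Rinv_r; nra].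
by have := pos_INR k; nra.
Qed.

Lemma protocol_error_gt (X Y Z : finType) (f g : relation3 X Y Z) (t : nat)
    (mu : X * Y -> R) (z : Z) (eps delta eta S : R)
    (p : proto {ffun 'I_t -> X} {ffun 'I_t -> Y} {ffun 'I_t -> Z}) :
  (0 < t)%N -> is_distr mu -> 0 < eps < 1 / 55 -> 0 <= eta -> 2 < 11 * eps * S ->
  prob mu (differ f g) <= delta ->
  rect_dense mu (rejects g z) eta (exp (- (S * ln 2))) ->
  delta + 22 * eps < eta * (prob mu (only_answer f z) - 33 * eps) ->
  INR (depth p) <= eps ^ 2 / 32 * INR t * (11 * eps * S) ->
  1 - (1 - eps) ^ nat_floor (eps ^ 2 * INR t / 32) <
    prob (prod_law (fun _ => mu)) (fun w => ~~ rel_pow f w.1 w.2 (run p w.1 w.2)).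
Proof.
set k := nat_floor _ => t_gt0 mu_distr eps_bounds eta_ge0 eps_S close dense gap depth_le.
apply: Rnot_le_lt => error_le.
have [M [lf [out [cardM lf_rect runE]]]] := run_has_leaves p.
have [[x0 y0]] := distr_inhabited mu_distr.
have pow_gt0 n : 0 < (1 - eps) ^ n by apply: pow_lt; lra.
have success_ge C : (1 - eps) ^ k <= success f mu lf out C.
  have : prob (prod_law (fun _ => mu)) (predC (solves_all f lf out C)) <= 1 - (1 - eps) ^ k.
    apply: Rle_trans error_le; apply: (prob_le (power_distr t mu_distr).1) => w; apply: contraNN.
    by move=> /forallP all_ok; apply/forall_inP => i _; have := all_ok i; rewrite runE.
  by rewrite prob_compl; [rewrite /success; lra | exact: power_distr].
have eps2t_ge0 : 0 <= eps ^ 2 * INR t by apply: Rmult_le_pos; [exact: pow2_ge_0 | exact: pos_INR].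
have k_le : INR k <= eps ^ 2 * INR t / 32 by apply: nat_floor_le; lra.
have S_gt : 10 < S by nra.
have ln2 := ln_lt_2; pose s := S * ln 2 / 4; have s_def : S * ln 2 = 4 * s by rewrite /s; lra.
rewrite s_def in dense.
have S_le : S <= 8 * s by rewrite /s; nra.
have step (C : {set 'I_t}) : (#|C| <= k)%N ->
    exists2 j, j \notin C & success f mu lf out (j |: C) < (1 - eps) * success f mu lf out C.
  move=> Ck; have success_gt0 := Rlt_le_trans _ _ _ (pow_gt0 k) (success_ge C).
  apply: (exists_failing_coordinate x0 y0 mu_distr lf_rect success_gt0 eps_bounds eta_ge0
    close dense gap) S_gt S_le _ _ _ => //; try nra.
  - apply: Rle_trans depth_le; apply: ln_leaves_le cardM _.
    exact: INR_card_gt0 (lf [ffun=> x0] [ffun=> y0]).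
  - apply: Rle_trans (neg_ln_le_of_pow_le _ (success_ge C)) _; first lra.
    by have := Rmult_le_compat_r (2 * eps) _ _ ltac:(lra) k_le; rewrite /=; lra.
  - by apply: Rle_trans k_le; exact/le_INR/leP.
have [||C success_le] := greedy_decay _ _ step; first lra.
  exact: prob_distr_le1 (power_distr t mu_distr).
by have := success_ge C; have := pow_gt0 k; move: success_le; rewrite /=; nra.
Qed.

Theorem theorem1 (X Y Z : finType) (f : relation3 X Y Z) (t : nat)
  (mu : X * Y -> R) (z : Z) (eps eps' delta : R) :
  (1 < t)%N ->
  is_distr mu ->
  let beta := prob mu (fun p => rel_at f p.1 p.2 == [set z]) in
  0 < eps -> eps < 1 / 3 -> 0 < eps' -> 0 < delta ->
  33 * eps < beta ->
  (delta + 22 * eps) / (beta - 33 * eps) < (1 + eps') * (delta / beta) ->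
  Rpub_ge (rel_pow f (t:=t))
    (1 - (1 - eps) ^ nat_floor (eps ^ 2 * INR t / 32))
    (eps ^ 2 / 32 * INR t *
       (11 * eps * srec mu f z ((1 + eps') * delta / beta) delta - 2)).
Proof.
move=> t_gt1 mu_distr beta eps_gt0 _ eps'_gt0 delta_gt0 beta_gt ratio_lt P P_wf P_err.
set eta := (1 + eps') * delta / beta; set S := srec _ _ _ _ _.
apply: Rnot_lt_le => cost_lt.
have scale_gt0 : 0 < eps ^ 2 / 32 * INR t.
  by apply: Rmult_lt_0_compat; [nra | apply/lt_0_INR/ltP; exact: ltnW].
have eps_S : 2 < 11 * eps * S by have := pos_INR (pub_cost P); nra.
have eta_ge0 : 0 <= eta by apply: Rdiv_ge0; nra.
have gap : delta + 22 * eps < eta * (beta - 33 * eps).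
  by apply/Rlt_div_l; rewrite /eta /Rdiv ?Rmult_assoc; lra.
have S_gt0 : 0 < S by nra.
have [g close dense] := srec_witness mu_distr.1 S_gt0.
have eta_lt1 : eta < 1.
  apply: rect_dense_lt1 dense mu_distr _; rewrite -exp_0; apply: exp_increasing.
  by rewrite -/S; have := ln_lt_2; nra.
have beta_le1 : beta <= 1 by exact: prob_distr_le1.
have eps_lt : eps < 1 / 55 by nra.
have [p p_depth p_err] := yao_deterministic_proto P_wf P_err (power_distr t mu_distr).
apply: Rlt_not_le p_err; apply: (protocol_error_gt (g := g) (z := z) (delta := delta)
  (eta := eta) (S := S)) => //; first exact: ltnW.
have cost_le : eps ^ 2 / 32 * INR t * (11 * eps * S - 2) <= eps ^ 2 / 32 * INR t * (11 * eps * S).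
  by lra.
by apply: Rle_trans (Rle_trans _ _ _ _ (Rlt_le _ _ cost_lt)) cost_le; exact/le_INR/leP.
Qed.
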